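(* Let $g_0\in L^\infty(\Omega')$ and let $(f_n,g_n)_{n\ge0}$ be the iterates of the coordinate ascent algorithm $$f_{n} := \operatorname*{argmax}_{f} \Gamma(f,g_n), \qquad g_{n+1} := \operatorname*{argmax}_{g} \Gamma(f_{n},g), \qquad n\geq 0 .$$ Then for all $n\ge 0$ $$\| g_{n+1} - g_{*} \|_{\infty} \leq \| f_{n} - f_{*} \|_{\infty}\leq \| g_{n} - g_{*} \|_{\infty} \leq \dots \leq \| g_0- g_* \|_\infty$$ and the suboptimality gap $\Delta_n : = \mathrm{QOT}_\varepsilon(P,Q)- \Gamma(f_n,g_n)$ satisfies $$\Delta_n \leq (1-q)^n \Delta_0\qquad\text{for}\qquad q:= \frac{\varepsilon} {2\gamma_\varepsilon\max(2\|g_{0} - g_*\|_\infty , \varepsilon)}.$$ Moreover, $$\|f_n\oplus g_n - f_*\oplus g_*\|_{L^2(P\otimes Q)}^2\leq \frac{2\gamma_\varepsilon^2\max(2\|g_{0} - g_*\|_\infty , \varepsilon)^2}{\varepsilon}\,\Delta_0\,(1-q)^n.$$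
   Context: Fix $d\ge 1$ and $\varepsilon>0$. $B_r(x)\subset\mathbb{R}^d$ is the open ball of center $x$ and radius $r>0$. $P$ and $Q$ are probability measures on $\mathbb{R}^d$ such that: $P$ has convex, compact support $\Omega$ and a density $\rho=dP/d\mathcal{L}_d$ with respect to Lebesgue measure $\mathcal{L}_d$ with $\lambda_P\le\rho(x)\le\Lambda_P$ for all $x\in\Omega$, for constants $0<\lambda_P<\Lambda_P<\infty$; $Q$ has compact support $\Omega'$. The cost $c:\mathbb{R}^d\times\mathbb{R}^d\to\mathbb{R}$ is Lipschitz with constant $L>0$. $\delta_P\in(0,1]$ is a constant (it exists and depends only on $\Omega$ and $\lambda_P$) such that $P(B_r(x))\ge\delta_P\min(r^d,1)$ for all $r>0$, $x\in\Omega$. Set $$\gamma_\varepsilon= 16 \left(\delta_P^{-1}\max\left( \frac{8L}{\varepsilon},1\right)^d\right) \frac{\Lambda_P^2}{\lambda_P^2}\,\frac{\bigl(\lceil 8L\,\mathrm{diam}(\Omega)/\varepsilon \rceil\bigr)^{d+2}}{\inf_{y\in\Omega'} Q\bigl(B_{\frac{\varepsilon}{8L}}(y)\bigr)}.$$ With $\Pi(P,Q)$ the set of couplings of $(P,Q)$, $$\mathrm{QOT}_\varepsilon(P,Q):=\inf_{\pi\in\Pi(P,Q)}\int c\,d\pi+\frac{\varepsilon}{2}\left\|\frac{d\pi}{d(P\otimes Q)}\right\|^2_{L^2(P\otimes Q)},$$ the last term being $+\infty$ if $\pi\not\ll P\otimes Q$. The dual objective $\Gamma:L^2(P)\times L^2(Q)\to\mathbb{R}$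 is $$\Gamma(f,g):=\int\Big(f(x)+g(y)-\frac{1}{2\varepsilon}\big(f(x)+g(y)-c(x,y)\big)_+^2\Big)\,d(P\otimes Q)(x,y),$$ where $(t)_+=\max(t,0)$. Write $(f\oplus g)(x,y):=f(x)+g(y)$. The coordinate ascent updates are equivalent to iteratively solving the first-order conditions: for $n\ge0$, define $f_n(x)$, $x\in\Omega$, via $$\varepsilon = \int \big( f_{n}(x) + g_{n}(y) - c(x,y) \big)_+ \, dQ(y),$$ then $g_{n+1}(y)$, $y\in\Omega'$, via $$\varepsilon = \int \big( f_{n}(x) + g_{n+1}(y) - c(x,y) \big)_+ \, dP(x).$$ These equations determine the iterates uniquely as bounded functions; these are the versions of $f_n,g_{n+1}$ used. Known facts: strong duality $\mathrm{QOT}_\varepsilon(P,Q)=\sup_{L^2(P)\times L^2(Q)}\Gamma$ holds; maximizers of $\Gamma$ exist and are unique up to $(f_*+a,g_*-a)$, $a\in\mathbb{R}$. The potentials $(f_*,g_* )$ are a fixed (arbitrary) maximizer, with versions $f_*:\Omega\to\mathbb{R}$, $g_*:\Omega'\to\mathbb{R}$ that are $L$-Lipschitz; they satisfy $\int (f_*(x)+g_*(y)-c(x,y))_+dQ(y)=\varepsilon$ for all $x\in\Omega$ and $\int (f_*(x)+g_*(y)-c(x,y))_+dP(x)=\varepsilon$ for all $y\in\Omega'$. $L^\infty(\Omega)$, $L^\infty(\Omega')$ are the spaces of bounded measurable functions, and $\|\cdot\|_\infty$ is the sup norm. *)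

(* Defs.v *)
From HB Require Import structures.
From mathcomp Require Export all_boot all_order all_algebra.
From mathcomp Require Export all_classical all_reals all_analysis measurable_realfun.
Export Order.TTheory GRing.Theory Num.Theory.
Export numFieldNormedType.Exports.

#[export] Set Implicit Arguments.
#[export] Unset Strict Implicit.
#[export] Unset Printing Implicit Defensive.

#[global] Open Scope classical_set_scope.
#[global] Open Scope ring_scope.
#[global] Open Scope charge_scope.

Definition matrix_display : measure_display. Proof. exact. Qed.

Section borel_matrix.
Context {R : realType} {m n : nat}.

Definition borel_matrix : set (set 'M[R]_(m, n)) :=
  <<s [set U : set 'M[R]_(m, n) | open U] >>.

Let borel0 : borel_matrix set0. Proof. exact: sigma_algebra0. Qed.

Let borelC A : borel_matrix A -> borel_matrix (~` A).
Proof. exact: sigma_algebraC. Qed.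

Let borel_bigcup (F : (set 'M[R]_(m, n))^nat) :
  (forall i, borel_matrix (F i)) -> borel_matrix (\bigcup_i F i).
Proof. exact: sigma_algebra_bigcup. Qed.

HB.instance Definition _ := @isMeasurable.Build matrix_display
  'M[R]_(m, n) borel_matrix borel0 borelC borel_bigcup.

Lemma open_measurable_mx (U : set 'M[R]_(m, n)) : open U -> measurable U.
Proof. by move=> oU; apply: sub_sigma_algebra. Qed.

Lemma measurable_coord_mx i j :
  measurable_fun setT (fun M : 'M[R]_(m, n) => M i j).
Proof.
apply: (@measurability _ _ _ _ _ _ (@RGenOpens.G R)).
  exact: RGenOpens.measurableE.
move=> _ [_ [a [b ->]] <-]; rewrite setTI; apply: open_measurable_mx.
by apply: open_comp; [move=> M _; exact: coord_continuous|exact: interval_open].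
Qed.

(* An open set is a countable union of balls (for the max norm of 'M[R]) with
   rational centers and radii. *)
Lemma measurable_fun_mxP d (T : measurableType d) (f : T -> 'M[R]_(m, n)) :
  measurable_fun setT f <->
  forall i j, measurable_fun setT (fun t => f t i j).
Proof.
split=> [mf i j|mf].
  exact: (measurableT_comp (measurable_coord_mx i j) mf).
apply: (@measurability _ _ _ _ _ _ [set U : set 'M[R]_(m, n) | open U]) => //.
move=> _ [U oU <-].
pose B (q : 'M[rat]_(m, n) * rat) : set 'M[R]_(m, n) :=
  @ball R 'M[R]_(m, n) (map_mx ratr q.1) (ratr q.2).
have -> : U = \bigcup_q (if `[< B q `<=` U >] then B q else set0).
  apply/seteqP; split; last first.
    by move=> x [q _]; case: ifPn => // /asboolP; exact.
  move=> x Ux.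
  have /nbhs_ballP[e /= e0 eU] := open_nbhs_nbhs (conj oU Ux).
  have [r /andP[r0 re]] : exists r : rat, (0 < ratr r :> R) && (ratr r < e / 2).
    have [|r] := @rat_in_itvoo R 0 (e / 2); first by rewrite divr_gt0.
    by rewrite in_itv /= => rP; exists r.
  have qP i j : exists q : rat, `|ratr q - x i j| < ratr r :> R.
    have [|q] := @rat_in_itvoo R (x i j - ratr r) (x i j + ratr r).
      by rewrite ltrD2l gtrN.
    by rewrite in_itv /= -ltr_distl => qP; exists q.
  pose q := \matrix_(i, j) xchoose (qP i j).
  have Bx : B (q, r) x.
    by split=> // i j; rewrite !mxE /=; exact: (xchooseP (qP i j)).
  exists (q, r) => //; rewrite ifT//; apply/asboolP => y Bqy; apply: eU.
  apply: (@ball_splitr R 'M[R]_(m, n) (map_mx ratr q)).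
    exact: (le_ball (ltW re) Bx).
  exact: (le_ball (ltW re) Bqy).
rewrite setTI preimage_bigcup; apply: countable_bigcupT_measurable.
  exact: countableP.
move=> q; case: ifPn => _; last by rewrite preimage_set0.
case: (ltP 0 (ratr q.2 : R)) => q0; last first.
  rewrite (_ : _ @^-1` _ = set0)//; apply/seteqP; split=> // t [+ _].
  by rewrite ltNge q0.
rewrite (_ : _ @^-1` _ = \bigcap_(ij : 'I_m * 'I_n)
    ((fun t => f t ij.1 ij.2) @^-1` @ball R R (ratr (q.1 ij.1 ij.2)) (ratr q.2))).
  apply: fin_bigcap_measurable => // ij _.
  rewrite -[X in measurable X]setTI; apply: mf => //.
  by apply: open_measurable; exact: ball_open.
apply/seteqP; split=> t /=.
  by move=> [_ tB] [i j] _; have := tB i j; rewrite mxE.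
by move=> tB; split=> // i j; have := tB (i, j) I; rewrite mxE.
Qed.

End borel_matrix.

Section lebesgue_cons.
Context {R : realType} {n : nat}.

Definition cons_rV (p : R * 'rV[R]_n) : 'rV[R]_n.+1 :=
  \row_j (if unlift ord0 j is Some i then p.2 0 i else p.1).

Definition uncons_rV (v : 'rV[R]_n.+1) : R * 'rV[R]_n :=
  (v 0 0, \row_j v 0 (lift ord0 j)).

Lemma cons_rVK : cancel cons_rV uncons_rV.
Proof.
move=> [r v]; rewrite /uncons_rV /cons_rV !mxE unlift_none; congr (_, _).
by apply/rowP => j; rewrite !mxE liftK.
Qed.

Lemma measurable_cons_rV : measurable_fun setT cons_rV.
Proof.
apply/measurable_fun_mxP => i j.
rewrite (_ : (fun t => _) = (if unlift ord0 j is Some k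
    then (fun p : R * 'rV[R]_n => p.2 0 k) else fst)); last first.
  by apply/funext => p; rewrite mxE; case: unlift.
case: unlift => [k|]; last exact: measurable_fst.
exact: (measurableT_comp (measurable_coord_mx 0 k) measurable_snd).
Qed.

Lemma measurable_uncons_rV : measurable_fun setT uncons_rV.
Proof.
apply/measurable_fun_pair; first exact: measurable_coord_mx.
apply/measurable_fun_mxP => i j.
rewrite (_ : (fun t => _) = (fun v : 'rV[R]_n.+1 => v 0 (lift ord0 j))).
  exact: measurable_coord_mx.
by apply/funext => v; rewrite mxE.
Qed.

Variable mu : {sigma_finite_measure set 'rV[R]_n -> \bar R}.

Definition lebesgue_cons : set 'rV[R]_n.+1 -> \bar R :=
  pushforward (lebesgue_measure \x mu)%E cons_rV.

Let lebesgue_cons0 : lebesgue_cons set0 = 0%E.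
Proof. by rewrite /lebesgue_cons /pushforward preimage_set0 measure0. Qed.

Let lebesgue_cons_ge0 A : (0 <= lebesgue_cons A)%E.
Proof. by rewrite /lebesgue_cons /pushforward. Qed.

Let lebesgue_cons_sigma_additive : semi_sigma_additive lebesgue_cons.
Proof.
exact: (@measure_semi_sigma_additive _ _ _
  (measure_function_pushforward__canonical__measure_function_Measure
     (lebesgue_measure \x mu)%E measurable_cons_rV)).
Qed.

HB.instance Definition _ := isMeasure.Build _ _ _ lebesgue_cons
  lebesgue_cons0 lebesgue_cons_ge0 lebesgue_cons_sigma_additive.

Let lebesgue_cons_sigma_finite : sigma_finite setT lebesgue_cons.
Proof.
have /sigma_finiteP[F [FT ndF mF]] := sigma_finiteT (@lebesgue_measure R).
have /sigma_finiteP[G [GT ndG mG]] := sigma_finiteT mu.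
exists (fun k => uncons_rV @^-1` (F k `*` G k)).
  rewrite -preimage_bigcup; apply/esym/seteqP; split=> // v _ /=.
  have [k _ Fk] : (\bigcup_i F i) (uncons_rV v).1 by rewrite -FT.
  have [l _ Gl] : (\bigcup_i G i) (uncons_rV v).2 by rewrite -GT.
  exists (maxn k l) => //; split.
    by move: Fk; exact/subsetPset/ndF/leq_maxl.
  by move: Gl; exact/subsetPset/ndG/leq_maxr.
move=> k; have [mFk Fk] := mF k; have [mGk Gk] := mG k; split.
  rewrite -[X in measurable X]setTI; apply: measurable_uncons_rV => //.
  exact: measurableX.
rewrite /lebesgue_cons /pushforward (_ : _ @^-1` _ = F k `*` G k); last first.
  by apply/funext => x; rewrite /preimage /mkset cons_rVK.
by rewrite product_measure1E// lte_mul_pinfty// ge0_fin_numE.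
Qed.

HB.instance Definition _ := Measure_isSigmaFinite.Build _ _ _ lebesgue_cons
  lebesgue_cons_sigma_finite.

End lebesgue_cons.

(* The n-fold product of the one-dimensional Lebesgue measure; lebesgue_rV_box
   gives its value on boxes. *)
Fixpoint lebesgue_rV {R : realType} (n : nat) :
    {sigma_finite_measure set 'rV[R]_n -> \bar R} :=
  match n with
  | 0%N => dirac (0 : 'rV[R]_0)
  | n'.+1 => lebesgue_cons (lebesgue_rV n')
  end.

Lemma lebesgue_rV_box (R : realType) (n : nat) (A : 'I_n -> set R) :
  (forall i, measurable (A i)) ->
  lebesgue_rV n [set v | forall i, A i (v 0 i)] =
  (\prod_i lebesgue_measure (A i))%E.
Proof.
elim: n A => [|n IHn] A mA.
  by rewrite big_ord0 /= diracE mem_set// => -[].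
pose B := [set v : 'rV[R]_n | forall i, A (lift ord0 i) (v 0 i)].
have mB : measurable B.
  rewrite (_ : B = \bigcap_(i : 'I_n)
      ((fun v : 'rV[R]_n => v 0 i) @^-1` A (lift ord0 i))).
    apply: fin_bigcap_measurable => // i _.
    by rewrite -[X in measurable X]setTI; apply: measurable_coord_mx.
  by apply/seteqP; split=> v vA i; [move=> _|]; exact: vA.
rewrite big_ord_recl -(IHn (fun i => A (lift ord0 i)))//.
transitivity ((lebesgue_measure \x lebesgue_rV n)%E (A ord0 `*` B)); last first.
  exact: (product_measure1E lebesgue_measure (lebesgue_rV n) (mA ord0) mB).
rewrite /= /lebesgue_cons /pushforward; congr (_ _).
apply/seteqP; split=> -[r v] /=.
  move=> rvA; split=> [|i]; first by have := rvA ord0; rewrite mxE unlift_none.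
  by have := rvA (lift ord0 i); rewrite mxE liftK.
by move=> [Ar vA] i; rewrite mxE; case: unliftP => [j ->|->].
Qed.

(* The library norm of 'rV[R]_d is the max norm, hence the Euclidean versions
   of the norm, of balls, of the diameter and of Lipschitz continuity below. *)

Section euclidean.
Context {R : realType} {d : nat}.
Local Notation T := 'rV[R]_d.

Definition enorm (v : T) : R := Num.sqrt (\sum_i v 0 i ^+ 2).

Definition eball (x : T) (r : R) : set T := [set y | enorm (y - x) < r].

Definition ediam (A : set T) : R :=
  sup [set r | exists x y, [/\ A x, A y & r = enorm (x - y)]].

Definition elipschitz_on (L : R) (A : set T) (f : T -> R) : Prop :=
  forall x y, A x -> A y -> `|f x - f y| <= L * enorm (x - y).

(* Lipschitz for the Euclidean norm of R^d x R^d = R^(2d). *)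
Definition elipschitz2 (L : R) (c : T * T -> R) : Prop :=
  forall z w, `|c z - c w| <=
    L * Num.sqrt (enorm (z.1 - w.1) ^+ 2 + enorm (z.2 - w.2) ^+ 2).

(* Topological support of a Borel measure. *)
Definition msupport (mu : set T -> \bar R) : set T :=
  [set x | forall U, open U -> U x -> (0 < mu U)%E].

Definition density (rho : T -> R) (P : set T -> \bar R) : Prop :=
  [/\ measurable_fun setT rho, (forall x, 0 <= rho x) &
    forall A, measurable A -> P A = (\int[lebesgue_rV d]_(x in A) (rho x)%:E)%E].

(* A function on A is represented by a function on the whole space, of which
   only the values on A matter; a bounded measurable function on a Borel set A
   can always be so represented, e.g. extending it by 0. *)
Definition Linfty (A : set T) (f : T -> R) : Prop :=
  measurable_fun setT f /\ [bounded f x | x in A].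

Definition supnorm (A : set T) (f : T -> R) : R :=
  sup [set `|f x| | x in A].

End euclidean.

Definition pospart {R : realType} (t : R) : R := Num.max t 0.

Definition is_argmax {R : realType} {U : Type} (D : set U) (F : U -> R)
    (u : U) : Prop :=
  D u /\ forall v, D v -> F v <= F u.

Definition L2 {R : realType} {d} {T : measurableType d}
    (mu : {measure set T -> \bar R}) : set (T -> R) :=
  [set f | f \in Lfun mu 2%:E].

Section qot.
Context {R : realType} {d : nat}.
Local Notation T := 'rV[R]_d.
Variables (P Q : probability T R) (c : T * T -> R) (eps : R).

Definition prodP : probability (T * T)%type R := (P \x Q)%E.

Definition coupling (pi : probability (T * T)%type R) : Prop :=
  forall A, measurable A ->
    pi (fst @^-1` A) = P A /\ pi (snd @^-1` A) = Q A.

(* Squared L^2(P (x) Q) norm of the density of pi; it is +oo as well when the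
   density exists but is not square integrable. *)
Definition sqr_density (pi : probability (T * T)%type R) : \bar R :=
  if `[< pi `<< prodP >] then
    ('N[prodP]_2%:E['d (charge_of_finite_measure pi) '/d prodP] ^+ 2)%E
  else +oo%E.

Definition QOT : \bar R :=
  ereal_inf [set (\int[pi]_z (c z)%:E + (eps / 2)%:E * sqr_density pi)%E
            | pi in coupling].

Definition oplus (f g : T -> R) : T * T -> R := fun z => f z.1 + g z.2.

Definition Gamma (f g : T -> R) : R :=
  \int[prodP]_z (oplus f g z
                 - (2 * eps)^-1 * pospart (oplus f g z - c z) ^+ 2).

Definition foc_left (Om : set T) (f g : T -> R) : Prop :=
  forall x, Om x -> \int[Q]_y pospart (f x + g y - c (x, y)) = eps.

Definition foc_right (Om' : set T) (f g : T -> R) : Prop :=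
  forall y, Om' y -> \int[P]_x pospart (f x + g y - c (x, y)) = eps.

Definition gap (f g : T -> R) : \bar R := (QOT - (Gamma f g)%:E)%E.

(* The argmax determines f n (resp. g n.+1) only almost everywhere; the
   first-order condition, imposed at every point of Om (resp. Om'), together
   with boundedness, selects the version. *)
Definition coordinate_ascent (Om Om' : set T) (f g : nat -> T -> R) : Prop :=
  forall n,
  [/\ is_argmax (L2 P) (fun h => Gamma h (g n)) (f n),
      Linfty Om (f n) & foc_left Om (f n) (g n)] /\
  [/\ is_argmax (L2 Q) (fun h => Gamma (f n) h) (g n.+1),
      Linfty Om' (g n.+1) & foc_right Om' (f n) (g n.+1)].

(* A maximizer of Gamma, in its L-Lipschitz version. *)
Definition potentials (L : R) (Om Om' : set T) (fs gs : T -> R) : Prop :=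
  [/\ is_argmax (L2 P `*` L2 Q) (fun h => Gamma h.1 h.2) (fs, gs),
      elipschitz_on L Om fs, elipschitz_on L Om' gs,
      foc_left Om fs gs & foc_right Om' fs gs].

Definition gamma_eps (Om Om' : set T) (L lamP LamP deltaP : R) : R :=
  16 * (deltaP^-1 * Num.max (8 * L / eps) 1 ^+ d) * (LamP ^+ 2 / lamP ^+ 2)
  * ((Num.ceil (8 * L * ediam Om / eps))%:~R ^+ (d + 2)
     / inf [set fine (Q (eball y (eps / (8 * L)))) | y in Om']).

End qot.

(* Main.v *)
Require Import Defs.
From HB Require Import structures.
From mathcomp Require Import ring lra.

(** Write [w = (fs - f) + (gs - g)] for the displacement from the current
    potentials to the maximizer, [U = fs + gs - c] for the optimal slack and
    [V = f + g - c] for the current one. All functions are first truncated to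
    the supports [Om] and [Om'], which have full measure; they become bounded
    and measurable, and nothing changes in the functional or in the first-order
    conditions.

    The sup-norm bounds are a comparison principle for the scalar equation
    [\int pospart (t + G) = eps], whose solution [t] is monotone and commutes
    with constants ([foc_level_dist]). In particular [|w|] never exceeds
    [M = max (2 * ||g 0 - gs||, eps)].

    Strong duality holds with an explicit primal optimizer: by the first-order
    conditions, [pospart U / eps] is the density of a coupling
    ([duality_attained]), while completing a square gives the other inequality
    ([weak_duality]). The gap is thus [Gamma fs gs - Gamma f g].

    For the linear rate, [fun u => pospart u ^+ 2] is not strongly convex, but it
    is so, with a constant of order [eps / M], along segments of length at most
    [M] issued from the region [S] where [U >= eps / 2]. Both the gap and the
    symmetrized divergence [I], the mean of the gradient times [w], therefore
    control the mean of [w ^+ 2] over [S] ([local_growth_gap],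
    [local_growth_breg]). A nonlocal Poincare inequality [nonlocal_poincare]
    recovers the mean of [w ^+ 2] over the whole product space. Every [x] in
    [Om] has a ball of partners [y] of radius [eps / (8 * L)] with [(x, y)] in
    [S], and close points share such a ball; so increments of [fs - f] along
    short steps are controlled by the local energy, and chaining along a
    segment, which stays in the convex set [Om], controls the variance of
    [fs - f]. Averaging over the endpoints of the segment is harmless since the
    homotheties push [P] to a measure dominated by a multiple of [P]
    ([segment_push]). Balls of partners in the other direction then control
    [gs - g] up to the constant that cancels the mean of [fs - f].

    The resulting inequality bounds the gap by the squared norm of the partial
    gradient ([gap_le_grad]); a gradient step of length [eps], which the exact
    maximization can only improve, hence contracts the gap by [1 - q]
    ([gap_contraction]). The last estimate combines the contraction with the
    quadratic growth. *)

(** * Bounded measurable functions *)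

(** The real-valued functions that are measurable and bounded on the whole
    space: all of them are integrable for a finite measure, and the class is
    stable under the operations and partial integrations below. *)
Definition bmf d (T : measurableType d) (R : realType) (F : T -> R) : Prop :=
  measurable_fun setT F /\ exists M : R, forall x, `|F x| <= M.

Section bmf_theory.
Context d (T : measurableType d) (R : realType).
Implicit Types F G : T -> R.

Lemma bmf_measurable F : bmf F -> measurable_fun setT F.
Proof. by case. Qed.

Lemma bmf_cst (k : R) : bmf (fun _ : T => k).
Proof. by split => //; exists `|k|. Qed.

Lemma bmfD F G : bmf F -> bmf G -> bmf (fun x => F x + G x).
Proof.
move=> [mF [A FA]] [mG [B GB]]; split; first exact: measurable_funD.
exists (A + B) => x; rewrite (le_trans (ler_normD _ _))//.
by rewrite lerD.
Qed.

Lemma bmfM F G : bmf F -> bmf G -> bmf (fun x => F x * G x).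
Proof.
move=> [mF [A FA]] [mG [B GB]]; split; first exact: measurable_funM.
by exists (A * B) => x; rewrite normrM ler_pM.
Qed.

Lemma bmfN F : bmf F -> bmf (fun x => - F x).
Proof.
move=> [mF [A FA]]; split; first exact: measurableT_comp.
by exists A => x; rewrite normrN.
Qed.

Lemma bmfB F G : bmf F -> bmf G -> bmf (fun x => F x - G x).
Proof. by move=> bF bG; apply: bmfD => //; exact: bmfN. Qed.

Lemma bmfX F n : bmf F -> bmf (fun x => F x ^+ n).
Proof.
move=> bF; elim: n => [|n IHn]; first exact: bmf_cst.
under eq_fun do rewrite exprS.
exact: bmfM.
Qed.

Lemma bmf_pospart F : bmf F -> bmf (fun x => pospart (F x)).
Proof.
move=> [mF [A FA]]; split; first exact: measurable_maxr.
exists A => x; rewrite (le_trans _ (FA x))// /pospart.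
by case: (leP (F x) 0) => // _; rewrite normr0.
Qed.

Lemma bmf_indic (A : set T) : measurable A -> bmf (\1_A : T -> R).
Proof.
move=> mA; split; first exact: measurable_indic.
by exists 1 => x; rewrite indicE; case: (x \in A); rewrite ?normr1 ?normr0.
Qed.

Lemma bmf_sum n (F : nat -> T -> R) : (forall i, (i < n)%N -> bmf (F i)) ->
  bmf (fun x => \sum_(i < n) F i x).
Proof.
move=> bF; elim: n bF => [|n IHn] bF.
  by under eq_fun do rewrite big_ord0; exact: bmf_cst.
under eq_fun do rewrite big_ord_recr /=.
by apply: bmfD; [apply: IHn => i /ltnW; exact: bF|exact: bF].
Qed.

Lemma bmf_comp d' (T' : measurableType d') (h : T' -> T) F :
  measurable_fun setT h -> bmf F -> bmf (fun x => F (h x)).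
Proof.
by move=> mh [mF [A FA]]; split; [exact: measurableT_comp|exists A].
Qed.

Variable mu : probability T R.

Lemma bmf_integrable F : bmf F -> mu.-integrable setT (EFin \o F).
Proof.
move=> [mF [M FM]]; apply: measurable_bounded_integrable => //.
  by rewrite ltey_eq fin_num_measure.
exists M; split; first exact: num_real.
by move=> r Mr x _; exact: le_trans (FM x) (ltW Mr).
Qed.

Lemma bint_cst (k : R) : \int[mu]_x k = k.
Proof. by rewrite Rintegral_cst//= probability_setT mulr1. Qed.

Lemma bintD F G : bmf F -> bmf G ->
  \int[mu]_x (F x + G x) = \int[mu]_x F x + \int[mu]_x G x.
Proof. by move=> bF bG; rewrite RintegralD//; exact: bmf_integrable. Qed.

Lemma bintB F G : bmf F -> bmf G ->
  \int[mu]_x (F x - G x) = \int[mu]_x F x - \int[mu]_x G x.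
Proof. by move=> bF bG; rewrite RintegralB//; exact: bmf_integrable. Qed.

Lemma bintZl k F : bmf F -> \int[mu]_x (k * F x) = k * \int[mu]_x F x.
Proof. by move=> bF; rewrite RintegralZl//; exact: bmf_integrable. Qed.

Lemma bintZr k F : bmf F -> \int[mu]_x (F x * k) = \int[mu]_x F x * k.
Proof. by move=> bF; rewrite RintegralZr//; exact: bmf_integrable. Qed.

Lemma bint_sum n (F : nat -> T -> R) : (forall i, (i < n)%N -> bmf (F i)) ->
  \int[mu]_x (\sum_(i < n) F i x) = \sum_(i < n) \int[mu]_x F i x.
Proof.
move=> bF; elim: n bF => [|n IHn] bF.
  rewrite big_ord0; under eq_Rintegral do rewrite big_ord0.
  exact: bint_cst.
rewrite big_ord_recr /=; under eq_Rintegral do rewrite big_ord_recr /=.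
rewrite bintD; [|apply: bmf_sum => i /ltnW; exact: bF|exact: bF].
by rewrite IHn// => i /ltnW; exact: bF.
Qed.

Lemma bint_EFin F : bmf F -> (\int[mu]_x (F x)%:E)%E = (\int[mu]_x F x)%:E.
Proof.
by move=> bF; rewrite /Rintegral fineK//; exact/integrable_fin_num/bmf_integrable.
Qed.

Lemma le_bint F G : bmf F -> bmf G -> (forall x, F x <= G x) ->
  \int[mu]_x F x <= \int[mu]_x G x.
Proof. by move=> bF bG FG; apply: le_Rintegral => //; exact: bmf_integrable. Qed.

(** Two measurable functions that agree on a set of full measure have the same
    integral. *)
Lemma eq_Rintegral_full (A : set T) F G : measurable A -> mu A = 1%E ->
  measurable_fun setT F -> measurable_fun setT G ->
  (forall x, A x -> F x = G x) -> \int[mu]_x F x = \int[mu]_x G x.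
Proof.
move=> mA A1 mF mG FG; congr fine; apply: ae_eq_integral => //.
- exact/measurable_EFinP.
- exact/measurable_EFinP.
- exists (~` A); split; first exact: measurableC.
    by apply: (etrans (probability_setC mu mA)); rewrite A1 subee.
  by move=> x /= nFG; apply: contra_not nFG => Ax _; rewrite FG.
Qed.

(** Monotonicity needs the comparison on a set of full measure only. *)
Lemma le_bint_full (A : set T) F G : measurable A -> mu A = 1%E ->
  bmf F -> bmf G ->
  (forall x, A x -> F x <= G x) -> \int[mu]_x F x <= \int[mu]_x G x.
Proof.
move=> mA A1 bF bG FG.
have b1 : bmf (\1_A : T -> R) by exact: bmf_indic.
have E H : bmf H -> \int[mu]_x H x = \int[mu]_x (H x * \1_A x).
  move=> bH; apply: (eq_Rintegral_full mA) => //.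
  - by case: bH.
  - by case: (bmfM bH b1).
  - by move=> x Ax; rewrite indicE mem_set// mulr1.
rewrite (E F)// (E G)//; apply: le_bint => [||x]; [exact: bmfM..|].
rewrite indicE; have [/set_mem/FG ?|] := boolP (x \in A); first by rewrite !mulr1.
by rewrite !mulr0.
Qed.

End bmf_theory.

Section bmf_fubini.
Context d1 d2 (X : measurableType d1) (Y : measurableType d2) (R : realType).
Variables (P : probability X R) (Q : probability Y R).
Implicit Types F : X * Y -> R.

Lemma bmf_pair2 F x : bmf F -> bmf (fun y => F (x, y)).
Proof. by move=> bF; apply: (@bmf_comp _ _ _ _ _ (pair x)) bF. Qed.

Lemma bmf_pair1 F y : bmf F -> bmf (fun x => F (x, y)).
Proof. by move=> bF; apply: (@bmf_comp _ _ _ _ _ (pair^~ y)) bF. Qed.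

Lemma bmf_fst (F : X -> R) : bmf F -> bmf (fun z : X * Y => F z.1).
Proof. by move=> bF; apply: (@bmf_comp _ _ _ _ _ fst) bF. Qed.

Lemma bmf_snd (F : Y -> R) : bmf F -> bmf (fun z : X * Y => F z.2).
Proof. by move=> bF; apply: (@bmf_comp _ _ _ _ _ snd) bF. Qed.

Let int_prod F : bmf F -> (P \x Q)%E.-integrable setT (EFin \o F).
Proof. exact: (@bmf_integrable _ _ _ (P \x Q)%E). Qed.

Lemma bmf_int2 F : bmf F -> bmf (fun x => \int[Q]_y F (x, y)).
Proof.
move=> bF; have [_ [M FM]] := bF; split.
  by apply: measurableT_comp => //; exact: measurable_fubini_F (int_prod bF).
exists M => x; rewrite (le_trans (le_normr_Rintegral _ _))//.
  exact/bmf_integrable/bmf_pair2.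
rewrite -[leRHS](bint_cst Q); apply: le_bint => //; last exact: bmf_cst.
have [mF _] := bmf_pair2 x bF; split; first exact: measurableT_comp.
by exists M => y; rewrite normr_id.
Qed.

Lemma bmf_int1 F : bmf F -> bmf (fun y => \int[P]_x F (x, y)).
Proof.
move=> bF; have [_ [M FM]] := bF; split.
  by apply: measurableT_comp => //; exact: measurable_fubini_G (int_prod bF).
exists M => y; rewrite (le_trans (le_normr_Rintegral _ _))//.
  exact/bmf_integrable/bmf_pair1.
rewrite -[leRHS](bint_cst P); apply: le_bint => //; last exact: bmf_cst.
have [mF _] := bmf_pair1 y bF; split; first exact: measurableT_comp.
by exists M => x; rewrite normr_id.
Qed.

Lemma bint12 F : bmf F ->
  \int[(P \x Q)%E]_z F z = \int[P]_x \int[Q]_y F (x, y).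
Proof.
move=> bF; rewrite /Rintegral -(integral12_prod_meas1 (int_prod bF)).
congr fine; apply: eq_integral => x _; rewrite /fubini_F fineK//.
exact/(@integrable_fin_num _ _ _ Q)/bmf_integrable/bmf_pair2.
Qed.

Lemma bint21 F : bmf F ->
  \int[(P \x Q)%E]_z F z = \int[Q]_y \int[P]_x F (x, y).
Proof.
move=> bF; rewrite /Rintegral -(integral21_prod_meas1 (int_prod bF)).
congr fine; apply: eq_integral => y _; rewrite /fubini_G fineK//.
exact/(@integrable_fin_num _ _ _ P)/bmf_integrable/bmf_pair1.
Qed.

Lemma bint_fst (F : X -> R) : bmf F ->
  \int[(P \x Q)%E]_z F z.1 = \int[P]_x F x.
Proof.
move=> bF; rewrite bint12; last exact: bmf_fst.
by apply: eq_Rintegral => x _ /=; rewrite bint_cst.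
Qed.

Lemma bint_snd (F : Y -> R) : bmf F ->
  \int[(P \x Q)%E]_z F z.2 = \int[Q]_y F y.
Proof.
move=> bF; rewrite bint21; last exact: bmf_snd.
by apply: eq_Rintegral => x _ /=; rewrite bint_cst.
Qed.

End bmf_fubini.

(** Closes goals stating that an explicit expression is bounded measurable. *)
Ltac bmf_tac := repeat first
  [ assumption | exact: bmf_cst | apply: bmf_indic; assumption
  | apply: bmf_fst | apply: bmf_snd
  | apply: bmfB | apply: bmfD | apply: bmfM | apply: bmfN
  | apply: bmf_pospart | apply: bmfX
  | apply: bmf_pair2 | apply: bmf_pair1 ].

(** * Quadratic growth and gradient domination for the dual objective *)

Section pospart_theory.
Context {R : realType}.
Implicit Types u v h : R.

Lemma pospart_ge0 u : 0 <= pospart u.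
Proof. by rewrite /pospart le_max lexx orbT. Qed.

Lemma pospartT u : 0 <= u -> pospart u = u.
Proof. by move=> u0; apply: max_idPl. Qed.

Lemma pospartF u : u <= 0 -> pospart u = 0.
Proof. by move=> u0; apply: max_idPr. Qed.

Lemma le_pospart u v : u <= v -> pospart u <= pospart v.
Proof.
move=> uv; case: (leP u 0) => u0; first by rewrite (pospartF u0) pospart_ge0.
by rewrite !pospartT// ltW// (lt_le_trans u0).
Qed.

(** The next two lemmas are the smoothness and the convexity of
    [fun v => pospart v ^+ 2], of derivative [2 * pospart v]. *)
Lemma pospart_sqr_upper v h :
  pospart (v + h) ^+ 2 <= pospart v ^+ 2 + 2 * (pospart v * h) + h ^+ 2.
Proof.
case: (leP v 0) => v0; case: (leP (v + h) 0) => vh0.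
- by rewrite !pospartF//; nra.
- by rewrite (pospartF v0) pospartT ?(ltW vh0)//; nra.
- by rewrite (pospartF vh0) pospartT ?(ltW v0)//; nra.
- by rewrite (pospartT (ltW v0)) (pospartT (ltW vh0)); nra.
Qed.

Lemma pospart_sqr_lower u v :
  pospart v ^+ 2 + 2 * (pospart v * (u - v)) <= pospart u ^+ 2.
Proof.
case: (leP v 0) => v0; case: (leP u 0) => u0.
- by rewrite !pospartF//; nra.
- by rewrite (pospartF v0) pospartT ?(ltW u0)//; nra.
- by rewrite (pospartF u0) pospartT ?(ltW v0)//; nra.
- by rewrite (pospartT (ltW v0)) (pospartT (ltW u0)); have := sqr_ge0 (u - v); nra.
Qed.

Lemma pospart_mono u v : 0 <= (pospart u - pospart v) * (u - v).
Proof.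
case: (leP u v) => uv; first by have := le_pospart uv; nra.
by have := le_pospart (ltW uv); nra.
Qed.

(** Above the level [t] the function [pospart u ^+ 2] is strongly convex along
    segments of length at most [M]. *)
Lemma pospart_sqr_growth (t M : R) u v : 0 < t -> t <= M -> t <= u ->
  `|u - v| <= M ->
  t * (u - v) ^+ 2 <=
  M * (pospart v ^+ 2 - pospart u ^+ 2 + 2 * (pospart u * (u - v))).
Proof.
move=> t0 tM tu; rewrite ler_norml => /andP[_ uvM].
have u0 : 0 <= u by lra.
rewrite (pospartT u0); case: (leP v 0) => v0; last first.
  rewrite (pospartT (ltW v0)).
  have -> : v ^+ 2 - u ^+ 2 + 2 * (u * (u - v)) = (u - v) ^+ 2 by ring.
  by rewrite ler_wpM2r// sqr_ge0.
rewrite (pospartF v0).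
have h1 : t * (u - v) <= u * M by nra.
have h2 : t * (u - v) ^+ 2 <= u * M * (u - v).
  by rewrite expr2 mulrA ler_wpM2r//; nra.
apply: (le_trans h2); rewrite -subr_ge0.
have -> : M * (0 ^+ 2 - u ^+ 2 + 2 * (u * (u - v))) - u * M * (u - v) =
  (M * u) * (- v) by ring.
by rewrite mulr_ge0// ?oppr_ge0//; nra.
Qed.

(** The analogous strong monotonicity of the derivative. *)
Lemma pospart_mono_growth (t M : R) u v : 0 < t -> t <= M -> t <= u ->
  `|u - v| <= M ->
  t * (u - v) ^+ 2 <= M * ((pospart u - pospart v) * (u - v)).
Proof.
move=> t0 tM tu; rewrite ler_norml => /andP[_ uvM].
have u0 : 0 <= u by lra.
rewrite (pospartT u0); case: (leP v 0) => v0; last first.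
  by rewrite (pospartT (ltW v0)) -expr2 ler_wpM2r// sqr_ge0.
rewrite (pospartF v0) subr0 mulrA expr2 mulrA ler_wpM2r//; first by nra.
by nra.
Qed.

End pospart_theory.

Section dual_analysis.
Context {R : realType} {d : nat}.
Local Notation T := 'rV[R]_d.
Variables (P Q : probability T R) (c : T * T -> R) (eps : R).
Hypotheses (eps0 : 0 < eps) (bc : bmf c).
Implicit Types f g h : T -> R.

(** The partial derivative of [Gamma] in its second argument, as a density
    with respect to [Q]. *)
Definition dual_grad f g (y : T) : R :=
  1 - eps^-1 * \int[P]_x pospart (f x + g y - c (x, y)).

Local Notation slack f g := (fun z : T * T => f z.1 + g z.2 - c z).

Lemma bmf_slack f g : bmf f -> bmf g -> bmf (slack f g).
Proof. by move=> bf bg; bmf_tac. Qed.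

Lemma bmf_dual_grad f g : bmf f -> bmf g -> bmf (dual_grad f g).
Proof.
move=> bf bg; apply: bmfB; first exact: bmf_cst.
apply: bmfM; first exact: bmf_cst.
apply: (bmf_int1 P Q (F := fun z => pospart (slack f g z))).
exact/bmf_pospart/bmf_slack.
Qed.

Lemma Gamma_bmfE f g : bmf f -> bmf g ->
  Gamma P Q c eps f g = \int[P]_x f x + \int[Q]_y g y -
    (2 * eps)^-1 * \int[(P \x Q)%E]_z pospart (slack f g z) ^+ 2.
Proof.
move=> bf bg; rewrite /Gamma /prodP /oplus /=.
have bV := bmf_slack bf bg.
rewrite bintB; [|by bmf_tac..].
by rewrite bintD ?bintZl ?(bint_fst _ _ bf) ?(bint_snd _ _ bg)//; bmf_tac.
Qed.

(** Under the first-order condition in the first variable, the density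
    [pospart (f + g - c) / eps] has first marginal [P] when tested against
    bounded functions. *)
Lemma int_slack_fst (A : set T) f g h : measurable A -> P A = 1%E ->
  bmf f -> bmf g -> bmf h -> foc_left Q c eps A f g ->
  \int[(P \x Q)%E]_z (pospart (slack f g z) * h z.1) = eps * \int[P]_x h x.
Proof.
move=> mA A1 bf bg bh foc; have bV := bmf_slack bf bg.
have bVp := bmf_pospart bV.
rewrite bint12; last by bmf_tac.
rewrite -bintZl//.
apply: (eq_Rintegral_full mA) => //.
- apply: bmf_measurable.
  apply: (bmf_int2 P Q (F := fun z => pospart (slack f g z) * h z.1)).
  by bmf_tac.
- by apply: bmf_measurable; bmf_tac.
move=> x Ax /=; rewrite bintZr ?foc//.
exact: (bmf_pair2 x bVp).
Qed.

Lemma int_slack_snd f g h : bmf f -> bmf g -> bmf h ->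
  \int[(P \x Q)%E]_z (pospart (slack f g z) * h z.2) =
  \int[Q]_y ((\int[P]_x pospart (f x + g y - c (x, y))) * h y).
Proof.
move=> bf bg bh; have bV := bmf_slack bf bg.
have bVp := bmf_pospart bV.
rewrite bint21; last by bmf_tac.
apply: eq_Rintegral => y _ /=; rewrite bintZr//.
exact: (bmf_pair1 y bVp).
Qed.

Lemma int_slack_snd_foc (B : set T) f g h : measurable B -> Q B = 1%E ->
  bmf f -> bmf g -> bmf h -> foc_right P c eps B f g ->
  \int[(P \x Q)%E]_z (pospart (slack f g z) * h z.2) = eps * \int[Q]_y h y.
Proof.
move=> mB B1 bf bg bh foc; have bV := bmf_slack bf bg.
have bVp := bmf_pospart bV.
rewrite int_slack_snd// -bintZl//.
apply: (eq_Rintegral_full mB) => //.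
- apply: bmf_measurable; apply: bmfM => //.
  exact: (bmf_int1 P Q (F := fun z => pospart (slack f g z))).
- by apply: bmf_measurable; bmf_tac.
by move=> y By /=; rewrite foc.
Qed.

(** Without the first-order condition in the second variable, the defect of the
    second marginal is the gradient. *)
Lemma int_slack_grad f g h : bmf f -> bmf g -> bmf h ->
  \int[(P \x Q)%E]_z (pospart (slack f g z) * h z.2) =
  eps * (\int[Q]_y h y - \int[Q]_y (dual_grad f g y * h y)).
Proof.
move=> bf bg bh; rewrite int_slack_snd//.
have bG := bmf_dual_grad bf bg.
rewrite -bintB ?bintZl//; [|by bmf_tac..].
rewrite -bintZl; last by bmf_tac.
apply: eq_Rintegral => y _; rewrite /dual_grad.
by field; rewrite gt_eqF.
Qed.

Lemma int_dual_grad0 (A : set T) f g : measurable A -> P A = 1%E ->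
  bmf f -> bmf g -> foc_left Q c eps A f g ->
  \int[Q]_y dual_grad f g y = 0.
Proof.
move=> mA A1 bf bg foc; have b1 := bmf_cst T (1 : R).
have := int_slack_fst mA A1 bf bg b1 foc.
have := int_slack_grad bf bg b1.
rewrite !bint_cst => -> /(mulfI (lt0r_neq0 eps0)).
under eq_Rintegral do rewrite mulr1.
by move=> ?; lra.
Qed.

(** One step of gradient ascent of length [eps] in the second variable. *)
Lemma Gamma_grad_step f g : bmf f -> bmf g ->
  eps / 2 * \int[Q]_y dual_grad f g y ^+ 2 <=
  Gamma P Q c eps f (fun y => g y + eps * dual_grad f g y) -
  Gamma P Q c eps f g.
Proof.
move=> bf bg; have bG := bmf_dual_grad bf bg; have bV := bmf_slack bf bg.
pose h y := eps * dual_grad f g y.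
have bh : bmf h by apply: bmfM => //; exact: bmf_cst.
rewrite !Gamma_bmfE//; last exact: bmfD.
have -> : \int[Q]_y (g y + h y) = \int[Q]_y g y + \int[Q]_y h y by rewrite bintD.
have bgh : bmf (slack f (fun y => g y + h y)) by bmf_tac.
have le1 : \int[(P \x Q)%E]_z pospart (slack f (fun y => g y + h y) z) ^+ 2 <=
    \int[(P \x Q)%E]_z pospart (slack f g z) ^+ 2 +
    2 * \int[(P \x Q)%E]_z (pospart (slack f g z) * h z.2) + \int[Q]_y h y ^+ 2.
  have bh2 : bmf (fun y => h y ^+ 2) by bmf_tac.
  rewrite -(bint_snd P Q bh2) -bintZl; last by bmf_tac.
  rewrite -!bintD; [|by bmf_tac..].
  apply: le_bint; [by bmf_tac..|].
  move=> z /=; rewrite (_ : _ - _ = slack f g z + h z.2); last by rewrite /=; ring.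
  exact: pospart_sqr_upper.
rewrite (int_slack_grad bf bg bh) in le1.
have e1 : \int[Q]_y (dual_grad f g y * h y) =
    eps * \int[Q]_y (dual_grad f g y) ^+ 2.
  rewrite -bintZl; last by bmf_tac.
  by apply: eq_Rintegral => y _; rewrite /h; ring.
have e2 : \int[Q]_y h y ^+ 2 = eps ^+ 2 * \int[Q]_y (dual_grad f g y) ^+ 2.
  rewrite -bintZl; last by bmf_tac.
  by apply: eq_Rintegral => y _; rewrite /h; ring.
rewrite e1 e2 in le1.
have i0 : 0 < (2 * eps)^-1 by rewrite invr_gt0 mulr_gt0.
rewrite -subr_ge0.
move/(ler_wpM2l (ltW i0)): le1; rewrite -subr_ge0; congr (_ <= _).
by rewrite /h; field; rewrite gt_eqF.
Qed.

Section gap.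
Variables (A B : set T) (fs gs f g : T -> R) (M : R) (S : set (T * T)).
Hypotheses (mA : measurable A) (A1 : P A = 1%E).
Hypotheses (mB : measurable B) (B1 : Q B = 1%E).
Hypotheses (bfs : bmf fs) (bgs : bmf gs) (bf : bmf f) (bg : bmf g).
Hypotheses (focsl : foc_left Q c eps A fs gs) (focsr : foc_right P c eps B fs gs).
Hypothesis focl : foc_left Q c eps A f g.

Let U := slack fs gs.
Let V := slack f g.
Let w (z : T * T) := (fs z.1 - f z.1) + (gs z.2 - g z.2).

Let UVw z : U z - V z = w z. Proof. by rewrite /U /V /w; ring. Qed.

Let bU : bmf U. Proof. exact: bmf_slack. Qed.
Let bV : bmf V. Proof. exact: bmf_slack. Qed.
Let bw : bmf w. Proof. by rewrite /w; bmf_tac. Qed.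
Let bUp : bmf (fun z => pospart (U z)). Proof. exact: bmf_pospart. Qed.
Let bVp : bmf (fun z => pospart (V z)). Proof. exact: bmf_pospart. Qed.
Let ba : bmf (fun x => fs x - f x). Proof. by bmf_tac. Qed.
Let bb : bmf (fun y => gs y - g y). Proof. by bmf_tac. Qed.

(** [eps] times the symmetrized Bregman divergence of [- Gamma] between
    [(fs, gs)] and [(f, g)]; it dominates the gap, and it is [eps] times the
    pairing of the gradient at [(f, g)] with the displacement. *)
Definition dual_breg := \int[(P \x Q)%E]_z ((pospart (U z) - pospart (V z)) * w z).

Let intUw : \int[(P \x Q)%E]_z (pospart (U z) * w z) =
  eps * (\int[P]_x (fs x - f x) + \int[Q]_y (gs y - g y)).
Proof.
under eq_Rintegral do rewrite /w mulrDr.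
rewrite [LHS]bintD; [|by bmf_tac..].
rewrite (int_slack_fst mA A1 bfs bgs ba focsl).
by rewrite (int_slack_snd_foc mB B1 bfs bgs bb focsr) -mulrDr.
Qed.

Let intVw : \int[(P \x Q)%E]_z (pospart (V z) * w z) =
  eps * (\int[P]_x (fs x - f x) + \int[Q]_y (gs y - g y) -
         \int[Q]_y (dual_grad f g y * (gs y - g y))).
Proof.
under eq_Rintegral do rewrite /w mulrDr.
rewrite [LHS]bintD; [|by bmf_tac..].
by rewrite (int_slack_fst mA A1 bf bg ba focl) (int_slack_grad bf bg bb) -mulrDr addrA.
Qed.

Lemma dual_breg_gradE :
  dual_breg = eps * \int[Q]_y (dual_grad f g y * (gs y - g y)).
Proof.
rewrite /dual_breg; under eq_Rintegral do rewrite mulrBl.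
rewrite [LHS]bintB; [|by bmf_tac..].
by rewrite intUw intVw; ring.
Qed.

(** As the gradient has mean zero, the displacement [gs - g] in the pairing may
    be replaced by the whole [w]. *)
Lemma dual_breg_grad2E :
  dual_breg = eps * \int[(P \x Q)%E]_z (dual_grad f g z.2 * w z).
Proof.
have bG := bmf_dual_grad bf bg.
rewrite dual_breg_gradE; congr (_ * _).
under [RHS]eq_Rintegral do rewrite /w mulrDr.
rewrite [RHS]bintD; [|by bmf_tac..].
have bGb : bmf (fun y => dual_grad f g y * (gs y - g y)) by bmf_tac.
rewrite (bint_snd _ _ bGb) bint12; last by bmf_tac.
rewrite (_ : \int[P]_x _ = 0) ?add0r//.
rewrite -[RHS](bint_cst P 0); apply: eq_Rintegral => x _ /=.
by rewrite bintZr// (int_dual_grad0 mA A1 bf bg focl) mul0r.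
Qed.

Let gapE : 2 * eps * (Gamma P Q c eps fs gs - Gamma P Q c eps f g) =
  2 * eps * (\int[P]_x (fs x - f x) + \int[Q]_y (gs y - g y)) -
  (\int[(P \x Q)%E]_z pospart (U z) ^+ 2 - \int[(P \x Q)%E]_z pospart (V z) ^+ 2).
Proof.
rewrite !Gamma_bmfE// !bintB// -/U -/V.
by field; rewrite gt_eqF.
Qed.

Lemma gap_le_breg :
  eps * (Gamma P Q c eps fs gs - Gamma P Q c eps f g) <= dual_breg.
Proof.
have : \int[(P \x Q)%E]_z pospart (V z) ^+ 2 +
    2 * \int[(P \x Q)%E]_z (pospart (V z) * w z) <=
    \int[(P \x Q)%E]_z pospart (U z) ^+ 2.
  rewrite -bintZl; last by bmf_tac.
  rewrite -bintD; [|by bmf_tac..].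
  apply: le_bint; [by bmf_tac..|] => z; rewrite -UVw.
  exact: pospart_sqr_lower.
have := gapE.
by rewrite intVw dual_breg_gradE; nra.
Qed.

Hypotheses (eM : eps / 2 <= M) (wM : forall z, `|w z| <= M).
Hypotheses (mS : measurable S) (SU : forall z, S z -> eps / 2 <= U z).

Let E := \int[(P \x Q)%E]_z (\1_S z * w z ^+ 2).

Let eps2 : 0 < eps / 2. Proof. by rewrite divr_gt0. Qed.
Let M0 : 0 < M. Proof. exact: lt_le_trans eps2 eM. Qed.

(** The gap controls the displacement quadratically on [S], where the slack of
    the maximizer is bounded from below. *)
Lemma local_growth_gap :
  E <= 4 * M * (Gamma P Q c eps fs gs - Gamma P Q c eps f g).
Proof.
have : eps / 2 * E <= M * (\int[(P \x Q)%E]_z pospart (V z) ^+ 2 -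
    \int[(P \x Q)%E]_z pospart (U z) ^+ 2 +
    2 * \int[(P \x Q)%E]_z (pospart (U z) * w z)).
  rewrite -bintZl; last by bmf_tac.
  rewrite -(bintZl _ 2); last by bmf_tac.
  rewrite -bintB; [|by bmf_tac..].
  rewrite -bintD; [|by bmf_tac..].
  rewrite -bintZl; last by bmf_tac.
  apply: le_bint; [by bmf_tac..|] => z; rewrite indicE.
  have [/set_mem Sz|_] := boolP (z \in S).
    by rewrite mul1r -UVw; apply: pospart_sqr_growth => //; [exact: SU|rewrite UVw].
  rewrite mul0r mulr0 mulr_ge0 ?(ltW M0)// -UVw.
  by have := pospart_sqr_lower (V z) (U z); lra.
have := gapE; rewrite intUw => h1 h2.
rewrite -(ler_pM2l eps2) (le_trans h2)// -subr_ge0.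
have -> : eps / 2 * (4 * M * (Gamma P Q c eps fs gs - Gamma P Q c eps f g)) =
  M * (2 * eps * (Gamma P Q c eps fs gs - Gamma P Q c eps f g)) by field.
rewrite h1 -mulrBr mulr_ge0 ?(ltW M0)// -subr_ge0 opprB.
by rewrite le_eqVlt; apply/orP; left; apply/eqP; ring.
Qed.

(** The same for the symmetrized divergence, with a constant better by a
    factor 2. *)
Lemma local_growth_breg : eps / 2 * E <= M * dual_breg.
Proof.
rewrite -!bintZl; [|by bmf_tac..].
apply: le_bint; [by bmf_tac..|] => z; rewrite indicE.
have [/set_mem Sz|_] := boolP (z \in S).
  by rewrite mul1r -UVw; apply: pospart_mono_growth => //; [exact: SU|rewrite UVw].
by rewrite mul0r mulr0 mulr_ge0 ?(ltW M0)// -UVw pospart_mono.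
Qed.

Variable kap : R.
Hypotheses (kap0 : 0 < kap) (WE : \int[(P \x Q)%E]_z w z ^+ 2 <= kap * E).

(** Gradient domination: a Poincare-type inequality between the mean square of
    [w] over the whole space and over [S] bounds the gap by the gradient. *)
Lemma gap_le_grad : Gamma P Q c eps fs gs - Gamma P Q c eps f g <=
  2 * kap * M * \int[Q]_y dual_grad f g y ^+ 2.
Proof.
have bG := bmf_dual_grad bf bg.
(* [I] is bounded by Young's inequality with weight [s], chosen so that the
   term in [w] absorbs exactly half of [2 * I] *)
set G2 := \int[Q]_y _; set I := eps^-1 * dual_breg.
pose s := 2 * kap * M; have s0 : 0 < s by rewrite !mulr_gt0.
have IE : I = \int[(P \x Q)%E]_z (dual_grad f g z.2 * w z).
  by rewrite /I dual_breg_grad2E mulKf// gt_eqF.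
have leI : 2 * I <= s * G2 + s^-1 * \int[(P \x Q)%E]_z w z ^+ 2.
  have bG2 : bmf (fun y => dual_grad f g y ^+ 2) by bmf_tac.
  rewrite IE /G2 -(bint_snd P Q bG2) -!bintZl; [|by bmf_tac..].
  rewrite -bintD; [|by bmf_tac..].
  apply: le_bint; [by bmf_tac..|] => z.
  rewrite -subr_ge0 (_ : _ - _ = s^-1 * (s * dual_grad f g z.2 - w z) ^+ 2).
    by rewrite mulr_ge0 ?sqr_ge0// invr_ge0 ltW.
  by field; rewrite gt_eqF.
have EI : E <= 2 * M * I.
  rewrite -(ler_pM2l eps2) (le_trans local_growth_breg)// /I -subr_ge0.
  by rewrite le_eqVlt; apply/orP; left; apply/eqP; field; rewrite gt_eqF.
have sW : s^-1 * \int[(P \x Q)%E]_z w z ^+ 2 <= I.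
  rewrite ler_pdivrMl// (le_trans WE)//.
  rewrite /s (_ : _ * I = kap * (2 * M * I)); last by ring.
  by rewrite ler_pM2l.
apply: (@le_trans _ _ I).
  by rewrite /I ler_pdivlMl// gap_le_breg.
by rewrite -/s -(lerD2r I) -mulr2n -mulr_natl (le_trans leI)// lerD2l.
Qed.

(** One gradient step in the second variable decreases the gap by a fixed
    proportion. *)
Lemma gap_decrease :
  eps / (4 * kap * M) * (Gamma P Q c eps fs gs - Gamma P Q c eps f g) <=
  Gamma P Q c eps f (fun y => g y + eps * dual_grad f g y) -
  Gamma P Q c eps f g.
Proof.
apply: le_trans (Gamma_grad_step bf bg).
have k4 : 0 < eps / (4 * kap * M) by rewrite divr_gt0// !mulr_gt0.
apply: (le_trans (ler_wpM2l (ltW k4) gap_le_grad)).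
rewrite -subr_ge0 le_eqVlt; apply/orP; left; apply/eqP.
by field; rewrite !gt_eqF.
Qed.

End gap.

End dual_analysis.

(** * Nonexpansiveness of the alternating updates *)

(** Comparison for the scalar first-order condition: the level [t] solving
    [\int pospart (t + G) = eps] depends monotonically on [G]. *)
Lemma foc_level_le d (Y : measurableType d) (R : realType)
    (Q : probability Y R) (G1 G2 : Y -> R) (t1 t2 al eps : R) :
  0 < eps -> bmf G1 -> bmf G2 -> (forall y, G2 y - G1 y <= al) ->
  \int[Q]_y pospart (t1 + G1 y) = eps ->
  \int[Q]_y pospart (t2 + G2 y) = eps -> t1 - t2 <= al.
Proof.
move=> eps0 bG1 bG2 G12 foc1 foc2; rewrite leNgt; apply/negP => lt_al.
pose be := t1 - t2 - al; have be0 : 0 < be by rewrite /be; lra.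
have b1 : bmf (fun y => t1 + G1 y) by bmf_tac.
have b2 : bmf (fun y => t2 + G2 y) by bmf_tac.
have [_ [K0 K0P]] := b2.
pose K := `|K0| + 1; have K_gt0 : 0 < K by rewrite /K ltr_wpDl.
have KP y : t2 + G2 y <= K.
  rewrite (le_trans (ler_norm _))// (le_trans (K0P y))//.
  by rewrite /K (le_trans (ler_norm _))// lerDl.
(* the positive part exceeds the lower one by a fixed proportion *)
have : (1 + be / K) * eps <= eps.
  rewrite -[in leLHS]foc2 -[in leRHS]foc1 -bintZl; last by bmf_tac.
  apply: le_bint; [by bmf_tac..|] => y.
  case: (leP (t2 + G2 y) 0) => s0.
    by rewrite (pospartF s0) mulr0 pospart_ge0.
  rewrite (pospartT (ltW s0)).
  apply: (@le_trans _ _ (t2 + G2 y + be)); last first.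
    apply: (@le_trans _ _ (t1 + G1 y)); last by rewrite le_max lexx.
    by have := G12 y; rewrite /be; lra.
  rewrite mulrDl mul1r lerD2l mulrAC -mulrA ler_piMr ?(ltW be0)//.
  by rewrite ler_pdivrMr// mul1r KP.
apply/negP; rewrite -ltNge mulrDl mul1r ltrDl.
by rewrite mulr_gt0// divr_gt0.
Qed.

Lemma foc_level_dist d (Y : measurableType d) (R : realType)
    (Q : probability Y R) (G1 G2 : Y -> R) (t1 t2 al eps : R) :
  0 < eps -> bmf G1 -> bmf G2 -> (forall y, `|G1 y - G2 y| <= al) ->
  \int[Q]_y pospart (t1 + G1 y) = eps ->
  \int[Q]_y pospart (t2 + G2 y) = eps -> `|t1 - t2| <= al.
Proof.
move=> eps0 bG1 bG2 G12 foc1 foc2; rewrite ler_norml; apply/andP; split.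
  rewrite lerNl opprB; apply: foc_level_le foc2 foc1 => // y.
  by have := G12 y; rewrite ler_norml => /andP[].
apply: foc_level_le foc1 foc2 => // y.
by have := G12 y; rewrite distrC ler_norml => /andP[].
Qed.

(** * A nonlocal Poincare inequality *)

Lemma sqr_sum_le (R : realType) n (v : 'I_n -> R) :
  (\sum_(i < n) v i) ^+ 2 <= n%:R * \sum_(i < n) v i ^+ 2.
Proof.
case: n v => [|n] v; first by rewrite !big_ord0 expr0n mul0r.
set s := \sum_(i < _) v i; pose m := s / n.+1%:R.
have n0 : n.+1%:R != 0 :> R by rewrite pnatr_eq0.
have : 0 <= \sum_(i < n.+1) (v i - m) ^+ 2 by apply: sumr_ge0 => i _; exact: sqr_ge0.
have -> : \sum_(i < n.+1) (v i - m) ^+ 2 =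
    \sum_(i < n.+1) v i ^+ 2 - s ^+ 2 / n.+1%:R.
  under eq_bigr do rewrite sqrrB.
  rewrite !big_split /= sumrN sumrMnl -mulr_suml -/s sumr_const card_ord.
  rewrite -[_ *+ 2]mulr_natr -[_ *+ n.+1]mulr_natr /m.
  by field.
by rewrite subr_ge0 ler_pdivrMr ?ltr0n// mulrC.
Qed.

(** A path discretized into [N] steps, with the increment of [a] over one step
    controlled by the values of [G] at its endpoints. *)
Lemma chain_sqr_le (R : realType) (X : Type) (a G : X -> R) (x : nat -> X) N
    (K : R) :
  (forall i, (i < N)%N ->
     (a (x i) - a (x i.+1)) ^+ 2 <= K * (G (x i) + G (x i.+1))) ->
  (a (x 0%N) - a (x N)) ^+ 2 <=
    N%:R * (K * \sum_(i < N) (G (x i) + G (x i.+1))).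
Proof.
move=> step; have -> : a (x 0%N) - a (x N) = \sum_(i < N) (a (x i) - a (x i.+1)).
  elim: N {step} => [|N IHN]; first by rewrite big_ord0 subrr.
  by rewrite big_ord_recr /= -IHN; ring.
rewrite (le_trans (sqr_sum_le _))// ler_wpM2l// mulr_sumr.
by apply: ler_sum => i _; exact: step.
Qed.

Section poincare.
Context d1 d2 (X : measurableType d1) (Y : measurableType d2) (R : realType).
Variables (P : probability X R) (Q : probability Y R).
Variables (a : X -> R) (b : Y -> R) (S : set (X * Y)).
Hypotheses (ba : bmf a) (bb : bmf b) (mS : measurable S).

Let w (z : X * Y) := a z.1 + b z.2.
Let F (z : X * Y) := \1_S z * w z ^+ 2.

Let bw : bmf w. Proof. by rewrite /w; bmf_tac. Qed.
Let bF : bmf F. Proof. by rewrite /F; bmf_tac. Qed.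

(** The part of the energy of [w] over [S] that is carried by the fiber of
    [x]. *)
Definition local_energy (x : X) := \int[Q]_y F (x, y).

Lemma bmf_local_energy : bmf local_energy.
Proof. exact: (bmf_int2 P Q bF). Qed.

Lemma local_energy_ge0 x : 0 <= local_energy x.
Proof. by apply: Rintegral_ge0 => y _; rewrite mulr_ge0 ?sqr_ge0. Qed.

(** If [x] and [x'] have a common set of [S]-neighbours of mass at least [m],
    then [a x - a x'] is controlled by the energies at these points. *)
Lemma common_neighbours (m : R) (D : set Y) x x' : 0 < m ->
  measurable D -> (m%:E <= Q D)%E ->
  (forall y, D y -> S (x, y) /\ S (x', y)) ->
  (a x - a x') ^+ 2 <= 2 / m * (local_energy x + local_energy x').
Proof.
move=> m0 mD mQD DS.
have : m * (a x - a x') ^+ 2 <= \int[Q]_y (\1_D y * (a x - a x') ^+ 2).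
  rewrite bintZr; last by bmf_tac.
  rewrite ler_wpM2r ?sqr_ge0// -lee_fin -bint_EFin; last by bmf_tac.
  by rewrite integral_indic// setIT.
have bFx z : bmf (fun y => F (z, y)) by exact: bmf_pair2.
move=> /le_trans/(_ _)-/(_ (2 * (local_energy x + local_energy x'))) le1.
rewrite mulrAC -[_ / m]mulrC ler_pdivlMl// le1//.
have bFF : bmf (fun y => F (x, y) + F (x', y)) by exact: bmfD.
have -> : 2 * (local_energy x + local_energy x') =
  \int[Q]_y (2 * (F (x, y) + F (x', y))) by rewrite bintZl// bintD.
have b2FF : bmf (fun y => 2 * (F (x, y) + F (x', y))).
  by apply: bmfM => //; exact: bmf_cst.
apply: le_bint => //; first by bmf_tac.
move=> y; rewrite indicE /F.
have [/set_mem/DS[Sx Sx']|_] := boolP (y \in D); last first.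
  by rewrite mul0r mulr_ge0// addr_ge0// mulr_ge0 ?sqr_ge0.
rewrite mul1r !indicE !mem_set// !mul1r /w /=.
by have := sqr_ge0 ((a x + b y) + (a x' + b y)); nra.
Qed.

Variables (A : set X) (B : set Y) (N : nat) (path : nat -> X * X -> X).
Variables (m p C : R).
Hypotheses (mA : measurable A) (A1 : P A = 1%E).
Hypotheses (mB : measurable B) (B1 : Q B = 1%E).
Hypotheses (m0 : 0 < m) (p0 : 0 < p).
(* [path 0 (x, x'), path 1 (x, x'), ...] is a discrete path from [x] to [x'] of
   [N] steps: two consecutive points have many common [S]-neighbours, and
   averaging over the endpoints pushes [P] forward to a measure dominated by
   [C] times [P]. *)
Hypothesis mpath : forall i, measurable_fun setT (path i).
Hypothesis path0 : forall x, path 0 x = x.1.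
Hypothesis pathN : forall x, path N x = x.2.
Hypothesis path_step : forall i x x', (i < N)%N -> A x -> A x' ->
  exists D, [/\ measurable D, (m%:E <= Q D)%E &
    forall y, D y -> S (path i (x, x'), y) /\ S (path i.+1 (x, x'), y)].
Hypothesis path_push : forall i (G : X -> R), (i <= N)%N -> bmf G ->
  (forall x, 0 <= G x) ->
  \int[(P \x P)%E]_z G (path i z) <= C * \int[P]_x G x.

Let E := \int[(P \x Q)%E]_z F z.

Let intG : \int[P]_x local_energy x = E.
Proof. by rewrite /E bint12. Qed.

Let bda : bmf (fun z : X * X => (a z.1 - a z.2) ^+ 2).
Proof. by bmf_tac. Qed.

(** Chaining along the paths bounds twice the variance of [a] by the energy of
    [w] over [S]. *)
Lemma local_variance :
  \int[(P \x P)%E]_z (a z.1 - a z.2) ^+ 2 <= 4 * N%:R ^+ 2 * C / m * E.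
Proof.
have bG i : bmf (fun z => local_energy (path i z)).
  by apply: bmf_comp bmf_local_energy.
have AA1 : (P \x P)%E (A `*` A) = 1%E.
  by rewrite [LHS]product_measure1E//= A1 mule1.
apply: (@le_trans _ _ (\int[(P \x P)%E]_z (N%:R * (2 / m *
    \sum_(i < N) (local_energy (path i z) + local_energy (path i.+1 z)))))).
  apply: (@le_bint_full _ _ _ (P \x P)%E (A `*` A)) => //.
  - exact: measurableX.
  - apply: bmfM; first exact: bmf_cst.
    apply: bmfM; first exact: bmf_cst.
    apply: (bmf_sum (F := fun i z =>
      local_energy (path i z) + local_energy (path i.+1 z))) => i _.
    exact: bmfD.
  - move=> [x x'] [Ax Ax']; rewrite /= -[X in a X - _]/((x, x').1).
    rewrite -[X in _ - a X]/((x, x').2) -path0 -pathN.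
    apply: (chain_sqr_le (x := path ^~ (x, x'))) => i iN.
    by have [D [mD mQ DS]] := path_step iN Ax Ax'; exact: common_neighbours DS.
have bs i : bmf (fun z => local_energy (path i z) + local_energy (path i.+1 z)).
  exact: bmfD.
have bsum := bmf_sum (fun i (_ : (i < N)%N) => bs i).
rewrite bintZl; last by apply: bmfM => //; exact: bmf_cst.
rewrite bintZl//.
rewrite (bint_sum _ (F := fun i z =>
  local_energy (path i z) + local_energy (path i.+1 z)))//.
rewrite (_ : _ * E = N%:R * (2 / m * (N%:R * (2 * (C * E))))); last first.
  by field; rewrite gt_eqF.
rewrite !ler_wpM2l ?divr_ge0 ?(ltW m0)//.
rewrite mulr_natl -[X in _ <= _ *+ X](card_ord N) -sumr_const.
apply: ler_sum => i _; rewrite bintD//.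
rewrite mulr_natl mulr2n -intG.
by rewrite lerD// path_push ?(ltnW (ltn_ord _))//; [exact: bmf_local_energy|
  exact: local_energy_ge0|exact: bmf_local_energy|exact: local_energy_ge0].
Qed.

Hypothesis neighbours_snd : forall y, B y ->
  exists D, [/\ measurable D, (p%:E <= P D)%E & forall x, D x -> S (x, y)].

Let am := \int[P]_x a x.

Let varE : \int[(P \x P)%E]_z (a z.1 - a z.2) ^+ 2 =
  2 * \int[P]_x (a x - am) ^+ 2.
Proof.
rewrite bint12//.
have E1 x : \int[P]_x' (a x - a x') ^+ 2 =
    (a x - am) ^+ 2 + \int[P]_x' (a x' - am) ^+ 2.
  rewrite (_ : (fun _ => _) = fun x' => (a x - am) ^+ 2 +
      ((2 * (a x - am)) * (am - a x') + (a x' - am) ^+ 2)); last first.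
    by apply/funext => x'; ring.
  rewrite bintD; [|by bmf_tac..]; rewrite bintD; [|by bmf_tac..].
  rewrite bintZl; last by bmf_tac.
  rewrite bintB; [|by bmf_tac..]; rewrite !bint_cst subrr mulr0 add0r.
  by [].
under eq_Rintegral do rewrite E1.
by rewrite bintD ?bint_cst; [ring|by bmf_tac..].
Qed.

(** Controlling [a] up to its mean also controls [b] up to the opposite
    constant, hence all of [w]. *)
Lemma nonlocal_poincare : p <= 1 ->
  \int[(P \x Q)%E]_z w z ^+ 2 <= (2 + 6 * N%:R ^+ 2 * C / m) / p * E.
Proof.
move=> p1; set VV := \int[(P \x P)%E]_z (a z.1 - a z.2) ^+ 2.
have VVE : \int[P]_x (a x - am) ^+ 2 = VV / 2.
  by rewrite /VV varE; field.
have VV0 : 0 <= VV by apply: Rintegral_ge0 => z _; exact: sqr_ge0.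
have E1 y : \int[P]_x (a x + b y) ^+ 2 = VV / 2 + (am + b y) ^+ 2.
  rewrite -VVE.
  rewrite (_ : (fun _ => _) = fun x => ((a x - am) ^+ 2 +
      (2 * (am + b y)) * (a x - am)) + (am + b y) ^+ 2); last first.
    by apply/funext => x'; ring.
  rewrite bintD; [|by bmf_tac..]; rewrite bintD; [|by bmf_tac..].
  rewrite bintZl; last by bmf_tac.
  by rewrite bintB; [rewrite !bint_cst subrr mulr0 addr0|by bmf_tac..].
have bFy y : bmf (fun x => F (x, y)) by exact: bmf_pair1.
have bF1 : bmf (fun y => \int[P]_x F (x, y)) by exact: (bmf_int1 P Q bF).
have le1 : p * \int[Q]_y (am + b y) ^+ 2 <= 2 * E + VV.
  rewrite -bintZl; last by bmf_tac.
  rewrite /E bint21// -bintZl// -(bint_cst Q VV) -bintD; [|by bmf_tac..].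
  apply: (@le_bint_full _ _ _ Q B); [by []|by []|by bmf_tac..|] => y By.
  have [D [mD pD DS]] := neighbours_snd By.
  have pP : p * (am + b y) ^+ 2 <= \int[P]_x (\1_D x * (am + b y) ^+ 2).
    rewrite bintZr; last by bmf_tac.
    rewrite ler_wpM2r ?sqr_ge0// -lee_fin -bint_EFin; last by bmf_tac.
    by rewrite integral_indic// setIT.
  rewrite (le_trans pP)// (_ : VV = 2 * (VV / 2)); last by field.
  have bFy1 := bFy y.
  rewrite -VVE -!bintZl; [|by bmf_tac..].
  rewrite -bintD; [|by bmf_tac..].
  apply: le_bint; [by bmf_tac..|] => x; rewrite indicE /F.
  have [/set_mem/DS Sx|_] := boolP (x \in D); last first.
    by rewrite mul0r addr_ge0// mulr_ge0 ?sqr_ge0// mulr_ge0 ?sqr_ge0.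
  rewrite mul1r indicE mem_set// mul1r /w /=.
  have := sqr_ge0 ((a x + b y) + (a x - am)).
  rewrite (_ : (am + b y) = (a x + b y) - (a x - am)); last by ring.
  by nra.
have WE : \int[(P \x Q)%E]_z w z ^+ 2 = VV / 2 + \int[Q]_y (am + b y) ^+ 2.
  rewrite bint21; last by bmf_tac.
  rewrite -(bint_cst Q (VV / 2)) -bintD; [|by bmf_tac..].
  by apply: eq_Rintegral => y _; rewrite /w /= E1.
rewrite WE mulrAC ler_pdivlMr// mulrDl.
have := local_variance; rewrite -/VV => lv.
have : VV / 2 * p <= VV / 2 by rewrite ler_piMr// divr_ge0.
have -> : (2 + 6 * N%:R ^+ 2 * C / m) * E =
  2 * E + 3 / 2 * (4 * N%:R ^+ 2 * C / m * E) by field; rewrite gt_eqF.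
by move: le1; rewrite mulrC; lra.
Qed.

End poincare.

(** * Euclidean geometry and Borel measures on row vectors *)

Lemma measurable_sqrt (R : realType) : measurable_fun [set: R] (@Num.sqrt R).
Proof. by apply: continuous_measurable_fun; exact: sqrt_continuous. Qed.

Section enorm_theory.
Context {R : realType} {d : nat}.
Local Notation T := 'rV[R]_d.
Implicit Types v x y : T.

Lemma enorm_ge0 v : 0 <= enorm v.
Proof. exact: sqrtr_ge0. Qed.

Lemma sqr_enorm v : enorm v ^+ 2 = \sum_i v 0 i ^+ 2.
Proof. by rewrite sqr_sqrtr// sumr_ge0// => i _; exact: sqr_ge0. Qed.

Lemma enormZ (k : R) v : enorm (k *: v) = `|k| * enorm v.
Proof.
rewrite /enorm -sqrtr_sqr -sqrtrM ?sqr_ge0// mulr_sumr.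
by congr Num.sqrt; apply: eq_bigr => i _; rewrite mxE exprMn.
Qed.

Lemma enorm0 : enorm (0 : T) = 0.
Proof. by rewrite -(scale0r (0 : T)) enormZ normr0 mul0r. Qed.

Lemma enorm_distC x y : enorm (x - y) = enorm (y - x).
Proof. by rewrite -opprB -scaleN1r enormZ normrN1 mul1r. Qed.

Lemma coord_le_enorm v i : `|v 0 i| <= enorm v.
Proof.
rewrite -sqrtr_sqr ler_wsqrtr// (bigD1 i)//= lerDl sumr_ge0// => j _.
exact: sqr_ge0.
Qed.

Lemma enorm_eq0 v : enorm v = 0 -> v = 0.
Proof.
move=> v0; apply/rowP => i; rewrite mxE; apply/eqP.
by rewrite -normr_le0 -v0 coord_le_enorm.
Qed.

Lemma enorm_le_coord v (e : R) : 0 <= e -> (forall i, `|v 0 i| <= e) ->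
  enorm v <= d%:R * e.
Proof.
move=> e0 ve; rewrite -(@ler_pXn2r _ 2) ?nnegrE ?mulr_ge0 ?enorm_ge0//.
rewrite sqr_enorm (@le_trans _ _ (\sum_(i < d) e ^+ 2))//.
  apply: ler_sum => i _; rewrite -[leLHS]ger0_norm ?sqr_ge0// normrX.
  by rewrite lerXn2r// ?nnegrE.
rewrite sumr_const card_ord -[_ ^+ 2 *+ _]mulr_natl exprMn ler_wpM2r ?sqr_ge0//.
by rewrite -natrX ler_nat; case: (d) => // k; rewrite expnS expn1 leq_pmulr.
Qed.

Lemma measurable_enorm d' (X : measurableType d') (F : X -> T) :
  measurable_fun setT F -> measurable_fun setT (fun t => enorm (F t)).
Proof.
move=> mF; apply: (@measurableT_comp _ _ _ _ _ _ (@Num.sqrt R)).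
  exact: measurable_sqrt.
apply: measurable_sum => i; apply: measurable_funX.
exact: (measurableT_comp (measurable_coord_mx 0 i) mF).
Qed.

Lemma measurable_subr_rV x : measurable_fun setT (fun y : T => y - x).
Proof.
apply/measurable_fun_mxP => i j; under eq_fun do rewrite !mxE.
by apply: measurable_funB => //; exact: measurable_coord_mx.
Qed.

Lemma measurable_eball x (r : R) : measurable (eball x r).
Proof.
rewrite /eball -[X in measurable X]setTI.
have := measurable_enorm (measurable_subr_rV x).
move=> /(_ measurableT `]-oo, r[%classic (measurable_itv _)).
by congr measurable; apply/seteqP; split => y /=; rewrite in_itv.
Qed.

Lemma rat_rV_dense x (e : R) : 0 < e ->
  exists q : 'rV[rat]_d, forall i, `|ratr (q 0 i) - x 0 i| < e.
Proof.
move=> e0.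
have qP i : exists q : rat, `|ratr q - x 0 i| < e.
  have [|q] := @rat_in_itvoo R (x 0 i - e) (x 0 i + e).
    by rewrite ltrD2l gtrN.
  by rewrite in_itv /= -ltr_distl => qP; exists q.
exists (\row_i xchoose (qP i)) => i; rewrite mxE; exact: (xchooseP (qP i)).
Qed.

Lemma ball_sub_eball (x : T) (e : R) : 0 < e -> @ball R T x e `<=` eball x (d.+1%:R * e).
Proof.
move=> e0 y [_ xy]; rewrite /eball /=.
apply: (@le_lt_trans _ _ (d%:R * e)); last by rewrite ltr_pM2r// ltr_nat.
apply: enorm_le_coord; first exact: ltW.
by move=> i; rewrite !mxE distrC; exact/ltW/(xy 0 i).
Qed.

Lemma coord_le_norm v i : `|v 0 i| <= `|v|.
Proof.
rewrite [leRHS]mx_normrE.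
exact: (le_bigmax _ (fun ij : 'I_1 * 'I_d => `|v ij.1 ij.2|) (0, i)).
Qed.

Lemma bounded_enorm (A : set T) : bounded_set A ->
  exists K : R, forall x y, A x -> A y -> enorm (x - y) <= K.
Proof.
move=> [M [_ /(_ (M + 1))]]; rewrite ltrDl ltr01 => /(_ isT) AM.
have norm_le x i : A x -> `|x 0 i| <= `|M + 1|.
  move=> Ax; rewrite (le_trans (coord_le_norm _ _))//.
  by rewrite (le_trans (AM _ Ax))// ler_norm.
exists (d%:R * (`|M + 1| + `|M + 1|)) => x y Ax Ay; apply: enorm_le_coord.
  exact: addr_ge0.
by move=> i; rewrite !mxE (le_trans (ler_normB _ _))// lerD// norm_le.
Qed.

End enorm_theory.

(** A Borel measure on the separable space ['rV[R]_d] is carried by its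
    support. *)
Lemma msupport_full (R : realType) d (P : probability 'rV[R]_d R) :
  measurable (msupport P) -> P (msupport P) = 1%E.
Proof.
move=> mS.
(* the complement of the support is covered by the null balls with rational
   center and radius *)
pose B (q : 'rV[rat]_d * rat) : set 'rV[R]_d :=
  @ball R 'rV[R]_d (map_mx ratr q.1) (ratr q.2).
pose F k : set 'rV[R]_d := if unpickle k is Some q then
  (if P (B q) == 0%E then B q else set0) else set0.
have oB q : open (B q).
  have [q0|q0] := ltP 0 (ratr q.2 : R); first exact: ball_open.
  rewrite (_ : B q = set0) ?open0//; apply/seteqP; split => // y [+ _].
  by rewrite ltNge q0.
have nF k : P.-negligible (F k).
  rewrite /F; case: unpickle => [q|]; last exact: negligible_set0.
  case: eqP => [B0|_]; last exact: negligible_set0.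
  by exists (B q); split => //; exact: open_measurable_mx.
have sub : ~` msupport P `<=` \bigcup_k F k.
  move=> x /existsNP[U /not_implyP[oU /not_implyP[Ux PU]]].
  have PU0 : P U = 0%E.
    by apply/eqP; rewrite -measure_le0 leNgt; exact/negP.
  have /nbhs_ballP[e /= e0 eU] := open_nbhs_nbhs (conj oU Ux).
  have [r /andP[r0 re]] : exists r : rat, (0 < ratr r :> R) && (ratr r < e / 2).
    have [|r] := @rat_in_itvoo R 0 (e / 2); first by rewrite divr_gt0.
    by rewrite in_itv /= => rP; exists r.
  have [q qP] := rat_rV_dense x r0.
  have Bx : B (q, r) x by split=> // i j; rewrite !mxE/= ord1; exact: qP.
  have BU : B (q, r) `<=` U.
    move=> y Bqy; apply: eU; apply: (@ball_splitr R 'rV[R]_d (map_mx ratr q)).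
      exact: (le_ball (ltW re) Bx).
    exact: (le_ball (ltW re) Bqy).
  exists (pickle (q, r)) => //; rewrite /F pickleK ifT//.
  rewrite -measure_le0 -PU0 le_measure// inE; exact: open_measurable_mx.
have : P.-negligible (~` msupport P).
  by apply: (negligibleS sub); exact: negligible_bigcup.
move=> /(measure_negligible (measurableC mS)).
have := probability_setC P (measurableC mS); rewrite setCK => -> ->.
by rewrite sube0.
Qed.

(** Lipschitz functions are measurable for the product of the Borel
    sigma-algebras. *)
Lemma elipschitz2_measurable (R : realType) d (L : R)
    (c : 'rV[R]_d * 'rV[R]_d -> R) : 0 < L -> elipschitz2 L c ->
  measurable_fun setT c.
Proof.
move=> L0 cL.
pose D (q : 'rV[rat]_d * 'rV[rat]_d) (z : 'rV[R]_d * 'rV[R]_d) : R :=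
  Num.sqrt (enorm (z.1 - map_mx ratr q.1) ^+ 2 +
            enorm (z.2 - map_mx ratr q.2) ^+ 2).
pose rq (q : 'rV[rat]_d * 'rV[rat]_d) : 'rV[R]_d * 'rV[R]_d :=
  (map_mx ratr q.1, map_mx ratr q.2).
have mD q : measurable_fun setT (D q).
  apply: (@measurableT_comp _ _ _ _ _ _ (@Num.sqrt R)).
    exact: measurable_sqrt.
  apply: measurable_funD; apply: measurable_funX; apply: measurable_enorm.
    by apply: (measurableT_comp (measurable_subr_rV _)); exact: measurable_fst.
  by apply: (measurableT_comp (measurable_subr_rV _)); exact: measurable_snd.
move=> _; apply: (measurability _ (RGenInftyO.measurableE R)) => //.
move=> _ [_ [t ->] <-]; rewrite setTI.
(* the sublevel set is the union of the sublevel sets of the cones that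
   dominate [c] with apex at a rational point *)
rewrite (_ : _ @^-1` _ = \bigcup_q [set z | c (rq q) + L * D q z < t]); last first.
  apply/seteqP; split => z /=; rewrite in_itv /=; last first.
    move=> [q _ /=]; apply: le_lt_trans.
    by have := cL z (rq q); rewrite ler_norml => /andP[_]; rewrite lerBlDl.
  move=> czt.
  pose e := (t - c z) / (4 * L * (d.+1)%:R).
  have e0 : 0 < e by rewrite divr_gt0 ?subr_gt0// !mulr_gt0.
  have [q1 q1P] := rat_rV_dense z.1 e0.
  have [q2 q2P] := rat_rV_dense z.2 e0.
  have near_rat (x : 'rV[R]_d) (q : 'rV[rat]_d) :
      (forall i, `|ratr (q 0 i) - x 0 i| < e) ->
      enorm (x - map_mx ratr q) < (d.+1)%:R * e.
    move=> qP; apply: (@le_lt_trans _ _ (d%:R * e)).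
      apply: enorm_le_coord; first exact: ltW.
      by move=> i; rewrite !mxE distrC; exact: ltW.
    by rewrite ltr_pM2r// ltr_nat.
  exists (q1, q2) => //=.
  have h1 := near_rat _ _ q1P; have h2 := near_rat _ _ q2P.
  have Dlt : L * D (q1, q2) z < (t - c z) / 2.
    have -> : (t - c z) / 2 = L * (2 * ((d.+1)%:R * e)).
      rewrite /e; have : d.+1%:R != 0 :> R by rewrite pnatr_eq0.
      by move: (d.+1%:R) => k k0; field; rewrite k0 gt_eqF.
    rewrite ltr_pM2l//.
    have de0 : 0 <= d.+1%:R * e by rewrite mulr_ge0// ltW.
    have de2 : 0 <= 2 * (d.+1%:R * e) by rewrite mulr_ge0.
    rewrite -(@ltr_pXn2r _ 2) ?nnegrE ?sqrtr_ge0//.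
    rewrite sqr_sqrtr ?addr_ge0 ?sqr_ge0//.
    have := enorm_ge0 (z.1 - map_mx ratr q1).
    have := enorm_ge0 (z.2 - map_mx ratr q2).
    by move: h1 h2; rewrite /=; set u := enorm _; set v := enorm _; nra.
  have := cL (rq (q1, q2)) z; rewrite ler_norml => /andP[_].
  rewrite (enorm_distC _ z.1) (enorm_distC _ z.2) -/(D (q1, q2) z).
  by move: Dlt; set w := L * _; lra.
apply: countable_bigcupT_measurable => // q.
have mq : measurable_fun setT (fun z => c (rq q) + L * D q z).
  by apply: measurable_funD => //; exact: measurable_funM.
have := mq measurableT `]-oo, t[%classic (measurable_itv _).
by rewrite setTI; congr measurable; apply/seteqP; split => y /=; rewrite in_itv.
Qed.

(** * Lebesgue measure under homotheties *)

Section lebesgue_affine.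
Context {R : realType}.

Let measurable_affine (s t : R) : measurable_fun [set: R] (fun x => s + t * x).
Proof. by apply: measurable_funD => //; exact: measurable_funM. Qed.

Lemma lebesgue_measure_affine (s t : R) (A : set R) : 0 < t -> measurable A ->
  lebesgue_measure ((fun x => s + t * x) @^-1` A) =
  ((t^-1)%:E * lebesgue_measure A)%E.
Proof.
move=> t0 mA.
have mphi : measurable_fun setT
  (fun x => s + t * x : measurableTypeR R) by exact: measurable_affine.
pose nu := [the measure _ _ of mscale (NngNum (ltW t0))
  (measure_function_pushforward__canonical__measure_function_Measure
    (@lebesgue_measure R) mphi)].
have -> : lebesgue_measure A = nu A.
  apply: (lebesgue_measure_unique (mu := nu)) => // _ [[a b] _ <-] /=.
  rewrite /mscale /= /pushforward.
  have -> : (fun x => s + t * x) @^-1` `]a, b]%classic =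
      `](a - s) / t, (b - s) / t]%classic.
    apply/seteqP; split => x /=; rewrite !in_itv /=;
      by rewrite ltr_pdivrMr// ler_pdivlMr// ltrBlDl lerBrDl (mulrC x).
  rewrite !lebesgue_measure_itv /= !lte_fin ltr_pM2r ?invr_gt0// ltrD2r.
  case: ifP => _; last by rewrite mule0.
  by rewrite -!EFinB -EFinM; congr EFin; field; rewrite gt_eqF.
rewrite /= /mscale /= /pushforward muleA -EFinM mulVf ?mul1e//.
by rewrite gt_eqF.
Qed.

Lemma measurable_affine_rV n (s : 'rV[R]_n) (t : R) :
  measurable_fun setT (fun x : 'rV[R]_n => s + t *: x).
Proof.
apply/measurable_fun_mxP => i j; under eq_fun do rewrite !mxE.
apply: measurable_funD => //; apply: measurable_funM => //.
exact: measurable_coord_mx.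
Qed.

Lemma lebesgue_rV_affine n (s : 'rV[R]_n) (t : R) (A : set 'rV[R]_n) :
  0 < t -> measurable A ->
  lebesgue_rV n ((fun x => s + t *: x) @^-1` A) =
  ((t^-1 ^+ n)%:E * lebesgue_rV n A)%E.
Proof.
move=> t0; elim: n s A => [|n IHn] s A mA.
  by rewrite expr0 mul1e /= !diracE; congr (_%:R%:E); congr nat_of_bool;
    apply/idP/idP => /set_mem H; apply/mem_set; move: H; rewrite /= thinmx0 ?(thinmx0 (_ + _)).
pose s' : 'rV[R]_n := \row_j s 0 (lift ord0 j).
pose B := cons_rV @^-1` A.
have mB : measurable B.
  by rewrite -[X in measurable X]setTI; exact: measurable_cons_rV.
pose g (r : R) := lebesgue_rV n (xsection B r).
have mg : measurable_fun setT g.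
  exact: (measurable_fun_xsection (lebesgue_rV n) mB).
transitivity (\int[lebesgue_measure]_r ((t^-1 ^+ n)%:E * g (s 0 0 + t * r)%R))%E.
  rewrite /= /lebesgue_cons /pushforward.
  apply: eq_integral => r _ /=.
  have -> : xsection (cons_rV @^-1` ((fun x => s + t *: x) @^-1` A)) r =
      (fun x => s' + t *: x) @^-1` xsection B (s 0 0 + t * r).
    apply/seteqP; split => u; rewrite /xsection /= !inE /B /=;
      rewrite (_ : cons_rV (s 0 0 + t * r, s' + t *: u) =
                   s + t *: cons_rV (r, u))//;
      apply/rowP => j; rewrite !mxE /=;
      by case: unliftP => [k|] ->; rewrite ?mxE.
  by rewrite IHn//; exact: measurable_xsection.
rewrite ge0_integralZl//; last 2 first.
  - exact: (measurableT_comp mg (measurable_affine (s 0 0) t)).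
  - by rewrite lee_fin exprn_ge0// invr_ge0 ltW.
have -> : (\int[lebesgue_measure]_r g (s 0 0 + t * r)%R =
    (t^-1)%:E * \int[lebesgue_measure]_r g r)%E.
  have mphi : measurable_fun setT
    (fun x => s 0 0 + t * x : measurableTypeR R) by exact: measurable_affine.
  have t0' : 0 <= t^-1 by rewrite invr_ge0 ltW.
  have := ge0_integral_mscale (@lebesgue_measure R) measurableT (NngNum t0') mg
    (fun r _ => measure_ge0 (lebesgue_rV n) (xsection B r)).
  move=> /= <-.
  have := @ge0_integral_pushforward _ _ (measurableTypeR R) (measurableTypeR R)
    R _ mphi (@lebesgue_measure R) _ _ measurableT mg
    (fun r _ => measure_ge0 (lebesgue_rV n) (xsection B r)).
  rewrite preimage_setT => <-.
  apply: eq_measure_integral => C mC _.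
  exact: lebesgue_measure_affine.
by rewrite muleA -EFinM exprSr.
Qed.

End lebesgue_affine.

Section density_bounds.
Context {R : realType} {d : nat}.
Local Notation T := 'rV[R]_d.
Variables (P : probability T R) (rho : T -> R) (Om : set T) (lam Lam : R).
Hypotheses (mOm : measurable Om) (Om1 : P Om = 1%E) (hrho : density rho P).
Hypotheses (lam0 : 0 < lam) (lamLam : lam <= Lam).
Hypothesis rho_bounds : forall x, Om x -> lam <= rho x <= Lam.

Lemma probability_setI_full A : measurable A -> P (A `&` Om) = P A.
Proof.
move=> mA; have D0 : P (A `\` Om) = 0%E.
  apply/eqP; rewrite -measure_le0; apply: (@le_trans _ _ (P (~` Om))).
    by apply: le_measure; rewrite ?inE; [exact: measurableD|exact: measurableC|move=> x []].
  by have := probability_setC P mOm; rewrite Om1 subee// => ->.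
by rewrite [RHS](measureDI P mA mOm) /= D0 add0e.
Qed.

Let mrho : measurable_fun setT (EFin \o rho).
Proof. by case: hrho => mr _ _; exact/measurable_EFinP. Qed.

(** [P] and the restriction of Lebesgue measure to [Om] are comparable. *)
Lemma density_upper A : measurable A ->
  (P A <= Lam%:E * lebesgue_rV d (A `&` Om))%E.
Proof.
move=> mA; have mAO : measurable (A `&` Om) by exact: measurableI.
case: hrho => _ rho0 PE; rewrite -probability_setI_full// PE//.
rewrite -integral_cst//; apply: ge0_le_integral => //.
- by move=> x _; rewrite lee_fin.
- exact: measurable_funS mrho.
- by move=> x [_ /rho_bounds/andP[_ ?]]; rewrite lee_fin.
Qed.

Lemma density_lower A : measurable A ->
  (lam%:E * lebesgue_rV d (A `&` Om) <= P A)%E.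
Proof.
move=> mA; have mAO : measurable (A `&` Om) by exact: measurableI.
case: hrho => _ rho0 PE; rewrite -probability_setI_full// PE//.
rewrite -integral_cst//; apply: ge0_le_integral => //.
- by move=> x _; rewrite lee_fin ltW.
- exact: measurable_funS mrho.
- by move=> x [_ /rho_bounds/andP[? _]]; rewrite lee_fin.
Qed.

Lemma density_not_singleton (d0 : (0 < d)%N) x : exists2 y, Om y & y != x.
Proof.
apply: contrapT => /forall2NP noty.
have xE : [set x] = [set v : T | forall i, [set x 0 i] (v 0 i)].
  by apply/seteqP; split => [v -> //|v /= vx]; apply/rowP => i; exact: vx.
have mx : measurable ([set x] : set T).
  rewrite xE (_ : [set v : T | _] = \bigcap_(i : 'I_d)
      ((fun v : T => v 0 i) @^-1` [set x 0 i])).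
    apply: fin_bigcap_measurable => // i _.
    by rewrite -[X in measurable X]setTI; exact: measurable_coord_mx.
  by apply/seteqP; split=> v vA i; [move=> _|]; exact: vA.
have leb0 : lebesgue_rV d [set x] = 0%E.
  rewrite xE (lebesgue_rV_box (A := fun i : 'I_d => [set x 0 i])); last first.
    by move=> i; exact: measurable_set1.
  by rewrite (bigD1 (Ordinal d0))//= lebesgue_measure_set1 mul0e.
have : P [set x] = 1%E.
  apply/eqP; rewrite eq_le probability_le1//= -Om1 le_measure// ?inE//.
  by move=> y Oy; have [//|/negP] := noty y; rewrite negbK => /eqP.
apply/eqP; rewrite lt_eqF//.
apply: (@le_lt_trans _ _ 0%E) => //.
apply: (le_trans (density_upper mx)).
rewrite (_ : lebesgue_rV d _ = 0%E) ?mule0//.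
apply/eqP; rewrite -measure_le0; apply: (@le_trans _ _ (lebesgue_rV d [set x])).
  by apply: le_measure; rewrite ?inE//; exact: measurableI.
by rewrite /= leb0.
Qed.

Hypothesis cOm : convex_set (Om : set (convex_lmodType T)).

Lemma convex_setE (t : R) (x x' : T) : 0 <= t <= 1 -> Om x -> Om x' ->
  Om ((1 - t) *: x + t *: x').
Proof.
move=> t01 Ox Ox'.
have := cOm (Itv01 (andP t01).1 (andP t01).2) (mem_set Ox') (mem_set Ox).
by move=> /set_mem; rewrite addrC.
Qed.

(** The image of [P] under the homothety of center [x] and ratio [t] is
    dominated by [P]. *)
Lemma homothety_measure (x : T) (t : R) (A : set T) : 0 < t <= 1 -> Om x -> measurable A ->
  (P ((fun x' : T => (1 - t) *: x + t *: x')%R @^-1` A) <=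
   (Lam / lam * t^-1 ^+ d)%:E * P A)%E.
Proof.
move=> /andP[t0 t1] Ox mA; set phi := fun _ => _.
have mphi : measurable_fun setT phi by exact: measurable_affine_rV.
have mpre B : measurable B -> measurable (phi @^-1` B).
  by move=> mB; rewrite -[X in measurable X]setTI; exact: mphi.
have Lam0 : 0 < Lam by exact: lt_le_trans lamLam.
apply: (le_trans (density_upper (mpre _ mA))).
have mAO : measurable (A `&` Om) by exact: measurableI.
apply: (@le_trans _ _ (Lam%:E * lebesgue_rV d (phi @^-1` (A `&` Om)))%E).
  apply: lee_wpmul2l; first by rewrite lee_fin ltW.
  apply: le_measure; rewrite ?inE; [apply: measurableI => //; exact: mpre|exact: mpre|].
  by move=> y [Ay Oy]; split => //; apply: convex_setE => //; rewrite t1 ltW.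
rewrite lebesgue_rV_affine// muleA -EFinM.
have t0' : 0 < t^-1 ^+ d by rewrite exprn_gt0// invr_gt0.
rewrite (_ : Lam / lam * t^-1 ^+ d = Lam * t^-1 ^+ d * lam^-1); last by ring.
rewrite [X in (_ <= X * _)%E]EFinM -muleA lee_pmul2l ?lte_fin ?mulr_gt0//.
by rewrite lee_pdivlMl//; exact: density_lower.
Qed.

Lemma homothety_int (x : T) (t : R) (G : T -> R) : 0 < t <= 1 -> Om x -> bmf G ->
  (forall y, 0 <= G y) ->
  \int[P]_x' G ((1 - t) *: x + t *: x') <= Lam / lam * t^-1 ^+ d * \int[P]_y G y.
Proof.
move=> t01 Ox bG G0; set phi := fun x' : T => (1 - t) *: x + t *: x'.
have mphi : measurable_fun setT phi by exact: measurable_affine_rV.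
have bGphi : bmf (fun x' => G (phi x')) by exact: bmf_comp.
have C0 : 0 <= Lam / lam * t^-1 ^+ d.
  have Lam0 : 0 < Lam by exact: lt_le_trans lamLam.
  by case/andP: t01 => t0 _; rewrite mulr_ge0 ?divr_ge0 ?exprn_ge0 ?invr_ge0// ltW.
rewrite -lee_fin EFinM -!bint_EFin//.
have mG : measurable_fun setT (EFin \o G) by exact/measurable_EFinP/bmf_measurable.
have := ge0_integral_mscale P measurableT (NngNum C0) mG (fun r _ => G0 r).
move=> /= <-.
have := ge0_integral_pushforward mphi P measurableT mG (fun r _ => G0 r).
rewrite preimage_setT => <-.
apply: ge0_le_measure_integral => // A mA.
exact: homothety_measure.
Qed.

(** Averaged over both endpoints of a segment cut into [N] parts, a function of
    the [i]-th subdivision point integrates to at most a constant, independent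
    of [i], times its mean: the ratio [i / N] of the homothety is at least
    [1 / N], except at [i = 0], where the subdivision point is the starting
    point itself. *)
Lemma segment_push (N i : nat) (G : T -> R) : (i <= N)%N -> (0 < N)%N ->
  bmf G -> (forall y, 0 <= G y) ->
  \int[(P \x P)%E]_z G ((1 - i%:R / N%:R) *: z.1 + (i%:R / N%:R) *: z.2) <=
  Lam / lam * N%:R ^+ d * \int[P]_y G y.
Proof.
move=> iN N0 bG G0.
have iG : 0 <= \int[P]_y G y by apply: Rintegral_ge0.
have N1 : 1 <= N%:R :> R by rewrite ler1n.
have Nd1 : 1 <= N%:R ^+ d :> R by rewrite exprn_ege1.
have C1 : 1 <= Lam / lam by rewrite ler_pdivlMr// mul1r.
case: i iN => [_|i iN].
  under eq_Rintegral do rewrite mul0r subr0 scale1r scale0r addr0.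
  by rewrite bint_fst// ler_peMl// -[leLHS]mulr1 ler_pM.
have mphi : measurable_fun setT (fun z : T * T =>
    (1 - i.+1%:R / N%:R) *: z.1 + (i.+1%:R / N%:R) *: z.2).
  apply/measurable_fun_mxP => k j; under eq_fun do rewrite !mxE.
  apply: measurable_funD; apply: measurable_funM => //.
    exact: (measurableT_comp (measurable_coord_mx k j) measurable_fst).
  exact: (measurableT_comp (measurable_coord_mx k j) measurable_snd).
have bGphi := bmf_comp mphi bG.
rewrite bint12//.
rewrite -[leRHS](bint_cst P).
apply: (le_bint_full mOm Om1) => //.
- exact: (bmf_int2 P P bGphi).
- exact: bmf_cst.
move=> x Ox /=.
have t01 : 0 < (i.+1%:R / N%:R : R) <= 1.
  by rewrite divr_gt0 ?ltr0n//= ler_pdivrMr ?ltr0n// mul1r ler_nat.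
apply: (le_trans (homothety_int t01 Ox bG G0)).
rewrite ler_wpM2r// ler_wpM2l ?(le_trans ler01)//.
rewrite lerXn2r ?nnegrE ?invr_ge0 ?(ltW (andP t01).1)// invf_div.
by rewrite ler_pdivrMr ?ltr0n// ler_peMr// ler1n.
Qed.

End density_bounds.

Lemma ler_ediam (R : realType) d (A : set 'rV[R]_d) x y : bounded_set A ->
  A x -> A y -> enorm (x - y) <= ediam A.
Proof.
move=> /bounded_enorm[K AK] Ax Ay; apply: ub_le_sup; last by exists x, y.
by exists K => _ [u [v [Au Av ->]]]; exact: AK.
Qed.

Lemma seq_lower_bound (R : realType) (I : eqType) (s : seq I) (F : I -> R) :
  (forall i, i \in s -> 0 < F i) -> exists2 m, 0 < m & forall i, i \in s -> m <= F i.
Proof.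
elim: s => [|i s IHs] F0; first by exists 1.
have [j js|m m0 mF] := IHs; first by apply: F0; rewrite inE js orbT.
exists (Num.min (F i) m); first by rewrite lt_min m0 F0// mem_head.
by move=> j; rewrite inE ge_min => /orP[/eqP ->|/mF ->]; rewrite ?lexx ?orbT.
Qed.

(** By compactness, the mass of balls of a given radius centered on the support
    is bounded away from zero. *)
Lemma inf_ball_gt0 (R : realType) d (Q : probability 'rV[R]_d R) (r : R) :
  compact (msupport Q) -> msupport Q !=set0 -> 0 < r ->
  0 < inf [set fine (Q (eball y r)) | y in msupport Q].
Proof.
move=> cQ [y0 Sy0] r0.
pose e := r / (2 * d.+1%:R); have e0 : 0 < e by rewrite divr_gt0// mulr_gt0.
pose B c := @ball R 'rV[R]_d c e.
have oB c : open (B c) by exact: ball_open.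
move: (cQ); rewrite compact_cover => /(_ _ (msupport Q) B).
move=> [//||D' D'S cov]; first by move=> x Sx; exists x => //; exact: ballxx.
have [|m m0 mD] := @seq_lower_bound R _ (finmap.enum_fset D') (fun c => fine (Q (B c))).
  move=> c cD; have /set_mem Sc := D'S _ cD.
  rewrite fine_gt0// Sc//=; [|exact: ballxx].
  by rewrite ltey_eq fin_num_measure//; exact: open_measurable_mx.
apply: (lt_le_trans m0); apply: lb_le_inf; first by exists (fine (Q (eball y0 r))), y0.
move=> _ [y Sy <-]; have [c cD yB] := cov y Sy.
apply: (le_trans (mD c cD)); apply: fine_le.
- by apply: fin_num_measure; exact: open_measurable_mx.
- by apply: fin_num_measure; exact: measurable_eball.
apply: le_measure; rewrite ?inE; [exact: open_measurable_mx|exact: measurable_eball|].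
move=> z cz.
have : @ball R 'rV[R]_d y (e + e) z.
  by apply: (ball_triangle _ cz); exact: ball_sym.
have ee0 : 0 < e + e by rewrite addr_gt0.
move=> /(ball_sub_eball ee0); congr (eball y _ z).
by rewrite /e; have : d.+1%:R != 0 :> R by []; move: (d.+1%:R) => k k0; field.
Qed.

(** * Strong duality *)

Section density_probability.
Context d (T : measurableType d) (R : realType).
Variables (mu : probability T R) (F : T -> R).
Hypotheses (bF : bmf F) (F0 : forall x, 0 <= F x) (F1 : \int[mu]_x F x = 1).

(** The probability with bounded density [F] with respect to [mu]; the proof
    arguments do not enter the value, they only key the probability structure. *)
Definition density_prob (_ : bmf F) (_ : forall x, 0 <= F x)
    (_ : \int[mu]_x F x = 1) : set T -> \bar R :=
  fun A => (\int[mu]_(x in A) (F x)%:E)%E.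

Let nu := density_prob bF F0 F1.

Let nu0 : nu set0 = 0%E. Proof. exact: integral_set0. Qed.

Let nu_ge0 A : (0 <= nu A)%E.
Proof. by apply: integral_ge0 => x _; rewrite lee_fin. Qed.

Let nu_sigma_additive : semi_sigma_additive nu.
Proof.
apply: (@semi_sigma_additive_nng_induced _ _ _ mu (EFin \o F)) => [|x].
  exact/measurable_EFinP/bmf_measurable.
by rewrite lee_fin.
Qed.

HB.instance Definition _ := isMeasure.Build _ _ _ nu nu0 nu_ge0 nu_sigma_additive.

Let nu_setT : nu setT = 1%E.
Proof. by rewrite /nu /density_prob bint_EFin// F1. Qed.

HB.instance Definition _ := Measure_isProbability.Build _ _ _ nu nu_setT.

Lemma ex_density_probability : exists pi : probability T R,
  forall A, measurable A -> pi A = (\int[mu]_(x in A) (F x)%:E)%E.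
Proof. by exists [the probability _ _ of nu]. Qed.

End density_probability.

Lemma sqr_Lnorm2 d (T : measurableType d) (R : realType)
    (mu : {measure set T -> \bar R}) (F : T -> R) :
  ('N[mu]_2%:E[EFin \o F] ^+ 2 = \int[mu]_x (F x ^+ 2)%:E)%E.
Proof.
transitivity ('N[mu]_2%:E[EFin \o F] `^ 2)%E.
  have := Lnorm_ge0 mu 2%:E (EFin \o F).
  case: (Lnorm _ _ _) => [r|_|//].
    rewrite lee_fin => r0.
    by rewrite poweR_EFin -[2]/(2%:R) powR_mulrn// -EFin_expe.
  by rewrite poweRyr// expe2 mulyy.
rewrite powR_Lnorm//; apply: eq_integral => x _ /=.
by rewrite -[2]/(2%:R) powR_mulrn// -normrX ger0_norm// sqr_ge0.
Qed.

Lemma integrable_bmfM d (T : measurableType d) (R : realType)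
    (mu : {measure set T -> \bar R}) (F h : T -> R) :
  bmf F -> mu.-integrable setT (EFin \o h) ->
  mu.-integrable setT (EFin \o (fun z => F z * h z)).
Proof.
move=> [mF [M FM]] ih.
have bF : [bounded F x | x in setT].
  by exists M; split; [exact: num_real|move=> r Mr x _; exact: le_trans (FM x) (ltW Mr)].
exact: (integrableMr measurableT mF bF ih).
Qed.

Section duality.
Context {R : realType} {d : nat}.
Local Notation T := 'rV[R]_d.
Variables (P Q : probability T R) (c : T * T -> R) (eps : R).
Hypotheses (eps0 : 0 < eps) (bc : bmf c).

Let mu := prodP P Q.

Local Notation slack f g := (fun z : T * T => f z.1 + g z.2 - c z).

Lemma coupling_int_fst (pi : probability (T * T)%type R) (f : T -> R) :
  coupling P Q pi -> bmf f -> \int[pi]_z f z.1 = \int[P]_x f x.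
Proof.
move=> cpl bf; congr fine.
have mfst : measurable_fun setT (@fst T T) by exact: measurable_fst.
have mf : measurable_fun setT (EFin \o f) by exact/measurable_EFinP/bmf_measurable.
transitivity (\int[pushforward pi (@fst T T)]_x (f x)%:E)%E.
  rewrite (@integral_pushforward _ _ _ _ _ _ mfst pi _ _ mf)//.
  exact: (bmf_integrable pi (bmf_fst T bf)).
by apply: eq_measure_integral => A mA _; have [] := cpl A mA.
Qed.

Lemma coupling_int_snd (pi : probability (T * T)%type R) (g : T -> R) :
  coupling P Q pi -> bmf g -> \int[pi]_z g z.2 = \int[Q]_x g x.
Proof.
move=> cpl bg; congr fine.
have msnd : measurable_fun setT (@snd T T) by exact: measurable_snd.
have mg : measurable_fun setT (EFin \o g) by exact/measurable_EFinP/bmf_measurable.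
transitivity (\int[pushforward pi (@snd T T)]_x (g x)%:E)%E.
  rewrite (@integral_pushforward _ _ _ _ _ _ msnd pi _ _ mg)//.
  exact: (bmf_integrable pi (bmf_snd T bg)).
by apply: eq_measure_integral => A mA _; have [] := cpl A mA.
Qed.

(** The density of a coupling, as a real-valued function. *)
Let dens (pi : probability (T * T)%type R) (z : T * T) : R :=
  fine (('d (charge_of_finite_measure pi) '/d mu) z).

Let densE (pi : probability (T * T)%type R) : pi `<< mu ->
  'd (charge_of_finite_measure pi) '/d mu = EFin \o dens pi.
Proof.
by move=> pimu; apply/funext => z; rewrite /dens /= fineK// Radon_Nikodym_fin_num.
Qed.

Let integrable_dens (pi : probability (T * T)%type R) : pi `<< mu -> mu.-integrable setT (EFin \o dens pi).
Proof. by move=> pimu; rewrite -densE//; exact: Radon_Nikodym_integrable. Qed.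

Let sqr_densityE (pi : probability (T * T)%type R) : pi `<< mu ->
  sqr_density P Q pi = (\int[mu]_z (dens pi z ^+ 2)%:E)%E.
Proof.
move=> pimu; rewrite /sqr_density; case: asboolP => [_|//].
by rewrite densE// sqr_Lnorm2.
Qed.

Let int_dens (pi : probability (T * T)%type R) F : pi `<< mu -> bmf F ->
  (\int[mu]_z (F z * dens pi z)%:E)%E = (\int[pi]_z F z)%:E.
Proof.
move=> pimu bF; rewrite -bint_EFin//.
have := Radon_Nikodym_change_of_variables pimu measurableT (bmf_integrable pi bF).
by move=> <-; apply: eq_integral => z _; rewrite densE.
Qed.

Let integrable_Mdens (pi : probability (T * T)%type R) F : pi `<< mu -> bmf F ->
  mu.-integrable setT (EFin \o (fun z => F z * dens pi z)).
Proof. by move=> pimu bF; apply: integrable_bmfM => //; exact: integrable_dens. Qed.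

(** Completing the square between the density of [pi] and the positive part of
    the slack. *)
Lemma weak_duality (pi : probability (T * T)%type R) (f g : T -> R) :
  coupling P Q pi -> bmf f -> bmf g ->
  ((Gamma P Q c eps f g)%:E <=
   \int[pi]_z (c z)%:E + (eps / 2)%:E * sqr_density P Q pi)%E.
Proof.
move=> cpl bf bg; have e2 : 0 < eps / 2 by rewrite divr_gt0.
rewrite bint_EFin//.
have [pimu|npimu] := pselect (pi `<< mu); last first.
  rewrite /sqr_density; case: asboolP => [//|_].
  by rewrite gt0_muley ?lte_fin// addey// leey.
rewrite sqr_densityE//.
have [|] := ltP (\int[mu]_z (dens pi z ^+ 2)%:E)%E +oo%E; last first.
  by rewrite leye_eq => /eqP ->; rewrite gt0_muley ?lte_fin// addey// leey.
move=> fin2.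
have mdens : measurable_fun setT (dens pi).
  by apply/measurable_EFinP; exact: measurable_int (integrable_dens pimu).
have i2 : mu.-integrable setT (EFin \o (fun z => dens pi z ^+ 2)).
  apply/integrableP; split; first exact/measurable_EFinP/measurable_funX.
  rewrite (_ : (\int[mu]_x _ = \int[mu]_z (dens pi z ^+ 2)%:E)%E)//.
  by apply: eq_integral => z _ /=; rewrite ger0_norm// sqr_ge0.
have bV := bmf_slack bc bf bg; have bVp := bmf_pospart bV.
pose K := \int[mu]_z (dens pi z ^+ 2).
have KE : (\int[mu]_z (dens pi z ^+ 2)%:E)%E = K%:E.
  by rewrite /K /Rintegral fineK//; exact: (@integrable_fin_num _ _ _ mu).
rewrite KE -EFinM -EFinD lee_fin.
have e1 : \int[pi]_z pospart (slack f g z) =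
    \int[mu]_z (pospart (slack f g z) * dens pi z).
  by rewrite [RHS]/Rintegral int_dens.
have bVp2 : bmf (fun z => pospart (slack f g z) ^+ 2) by exact: bmfX.
have e3 : \int[mu]_z (pospart (slack f g z) * dens pi z) <=
    eps / 2 * K + (2 * eps)^-1 * \int[mu]_z pospart (slack f g z) ^+ 2.
  have i2' : mu.-integrable setT (EFin \o (fun z => eps / 2 * dens pi z ^+ 2)).
    by apply: integrable_bmfM => //; exact: bmf_cst.
  have iV2 : mu.-integrable setT
      (EFin \o (fun z => (2 * eps)^-1 * pospart (slack f g z) ^+ 2)).
    by apply: bmf_integrable; apply: bmfM => //; exact: bmf_cst.
  rewrite /K -RintegralZl// -bintZl// -RintegralD//.
  apply: le_Rintegral => //; first exact: integrable_Mdens.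
    exact: (integrableD measurableT i2' iV2).
  move=> z _; rewrite -subr_ge0.
  rewrite (_ : _ - _ = (2 * eps)^-1 *
    (eps * dens pi z - pospart (slack f g z)) ^+ 2).
    by rewrite mulr_ge0 ?sqr_ge0// invr_ge0 mulr_ge0// ltW.
  by field; rewrite gt_eqF.
have e4 : \int[pi]_z slack f g z =
    \int[P]_x f x + \int[Q]_y g y - \int[pi]_z c z.
  have b1 := bmf_fst T bf; have b2 := bmf_snd T bg.
  rewrite bintB//; last exact: bmfD.
  by rewrite bintD// (coupling_int_fst cpl bf) (coupling_int_snd cpl bg).
have e5 : \int[pi]_z slack f g z <= \int[pi]_z pospart (slack f g z).
  by apply: le_bint => // z; rewrite le_max lexx.
rewrite Gamma_bmfE//.
by move: e3 e4 e5; rewrite -e1 /mu /prodP; lra.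
Qed.

Variables (A B : set T) (fs gs : T -> R).
Hypotheses (mA : measurable A) (A1 : P A = 1%E).
Hypotheses (mB : measurable B) (B1 : Q B = 1%E).
Hypotheses (bfs : bmf fs) (bgs : bmf gs).
Hypotheses (focsl : foc_left Q c eps A fs gs) (focsr : foc_right P c eps B fs gs).

(** The first-order conditions say that the rescaled positive part of the
    slack is the density of a coupling, which is then optimal. *)
Lemma duality_attained : exists2 pi : probability (T * T)%type R,
  coupling P Q pi &
  (\int[pi]_z (c z)%:E + (eps / 2)%:E * sqr_density P Q pi =
   (Gamma P Q c eps fs gs)%:E)%E.
Proof.
have bV := bmf_slack bc bfs bgs; have bVp := bmf_pospart bV.
pose F z := eps^-1 * pospart (slack fs gs z).
have bF : bmf F by apply: bmfM => //; exact: bmf_cst.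
have F0 z : 0 <= F z by rewrite mulr_ge0 ?pospart_ge0// invr_ge0 ltW.
have Ffst h : bmf h -> \int[mu]_z (F z * h z.1) = \int[P]_x h x.
  move=> bh; under eq_Rintegral do rewrite -mulrA.
  have bh1 := bmf_fst T bh.
  rewrite bintZl; last exact: bmfM.
  by rewrite (int_slack_fst bc mA A1 bfs bgs bh focsl) mulKf// gt_eqF.
have Fsnd h : bmf h -> \int[mu]_z (F z * h z.2) = \int[Q]_x h x.
  move=> bh; under eq_Rintegral do rewrite -mulrA.
  have bh2 := bmf_snd T bh.
  rewrite bintZl; last exact: bmfM.
  by rewrite (int_slack_snd_foc bc mB B1 bfs bgs bh focsr) mulKf// gt_eqF.
have F1 : \int[mu]_z F z = 1.
  rewrite -(bint_cst P 1) -Ffst; last exact: bmf_cst.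
  by apply: eq_Rintegral => z _; rewrite mulr1.
have [pi piE] := ex_density_probability bF F0 F1.
have setE C : measurable C -> pi C = (\int[mu]_z (F z * \1_C z))%:E.
  move=> mC; rewrite piE// integral_mkcond -bint_EFin; last first.
    by apply: bmfM => //; exact: bmf_indic.
  apply: eq_integral => z _; rewrite patchE indicE.
  by case: ifP => _; rewrite ?mulr1 ?mulr0.
have cpl : coupling P Q pi.
  move=> C mC; have bC : bmf (\1_C : T -> R) by exact: bmf_indic.
  have mfst : measurable (fst @^-1` C : set (T * T)).
    by rewrite -[X in measurable X]setTI; exact: measurable_fst.
  have msnd : measurable (snd @^-1` C : set (T * T)).
    by rewrite -[X in measurable X]setTI; exact: measurable_snd.
  split.
    rewrite setE// (Ffst _ bC) -bint_EFin//.
    by rewrite integral_indic// setIT.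
  rewrite setE// (Fsnd _ bC) -bint_EFin//.
  by rewrite integral_indic// setIT.
have pimu : pi `<< mu.
  apply/null_content_dominatesP => C mC C0; rewrite piE//.
  by apply: null_set_integral => //; apply/measurable_funTS/measurable_EFinP/bmf_measurable.
have aeF : ae_eq mu setT (EFin \o dens pi) (EFin \o F).
  apply: integral_ae_eq => //.
  - exact: integrable_dens.
  - exact/measurable_EFinP/bmf_measurable.
  move=> C _ mC; rewrite -piE// -densE//.
  exact: (esym (Radon_Nikodym_integral (nu := charge_of_finite_measure pi) pimu mC)).
exists pi => //.
have mdens : measurable_fun setT (dens pi).
  by apply/measurable_EFinP; exact: measurable_int (integrable_dens pimu).
have bF2 : bmf (fun z => F z ^+ 2) by exact: bmfX.
have E1 : sqr_density P Q pi = (\int[mu]_z F z ^+ 2)%:E.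
  rewrite sqr_densityE// -bint_EFin//; apply: ae_eq_integral => //.
  - exact/measurable_EFinP/measurable_funX.
  - exact/measurable_EFinP/bmf_measurable.
  - by apply: filterS aeF => z /= /(_ I) [->].
have E2 : (\int[pi]_z (c z)%:E = (\int[mu]_z (F z * c z))%:E)%E.
  have bFc : bmf (fun z => F z * c z) by exact: bmfM.
  rewrite -(bint_EFin mu bFc) (bint_EFin pi bc) -int_dens//.
  apply: ae_eq_integral => //.
  - by apply/measurable_EFinP/measurable_funM => //; exact: bmf_measurable.
  - by apply/measurable_EFinP/bmf_measurable/bmfM.
  - by apply: filterS aeF => z /= /(_ I) [->]; rewrite mulrC.
rewrite E1 E2 -EFinM -EFinD; congr EFin.
rewrite Gamma_bmfE// -(Ffst _ bfs) -(Fsnd _ bgs).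
have b1 := bmf_fst T bfs; have b2 := bmf_snd T bgs.
have bVp2 : bmf (fun z => pospart (slack fs gs z) ^+ 2) by exact: bmfX.
rewrite -bintD; [|by bmf_tac..].
rewrite -!bintZl; [|by bmf_tac..].
rewrite -bintB; [|by bmf_tac..].
rewrite -bintD; [|by bmf_tac..].
apply: eq_Rintegral => z _; rewrite /F.
have : pospart (slack fs gs z) * slack fs gs z = pospart (slack fs gs z) ^+ 2.
  case: (leP 0 (slack fs gs z)) => [/pospartT ->|/ltW/pospartF ->]; first by rewrite expr2.
  by rewrite mul0r expr0n.
set u := pospart _ => uE.
have uE' : u * (fs z.1 + gs z.2) = u ^+ 2 + u * c z by rewrite -uE /=; ring.
rewrite -mulrDr -[X in _ = X - _]mulrA uE'.
by field; rewrite gt_eqF.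
Qed.

End duality.

Section duality_truncated.
Context {R : realType} {d : nat}.
Local Notation T := 'rV[R]_d.
Variables (P Q : probability T R) (A B : set T).
Hypotheses (mA : measurable A) (A1 : P A = 1%E).
Hypotheses (mB : measurable B) (B1 : Q B = 1%E).

Lemma prodP_full : prodP P Q (A `*` B) = 1%E.
Proof. by rewrite [LHS]product_measure1E//= A1 B1 mule1. Qed.

Lemma coupling_full pi : coupling P Q pi -> pi (A `*` B) = 1%E.
Proof.
move=> cpl; have mAB : measurable (A `*` B) by exact: measurableX.
have := probability_setC pi (measurableC mAB); rewrite setCK => ->.
rewrite (_ : pi (~` (A `*` B)) = 0%E) ?sube0//.
have mA' : measurable (fst @^-1` (~` A) : set (T * T)).
  by rewrite -[X in measurable X]setTI; apply: measurable_fst => //; exact: measurableC.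
have mB' : measurable (snd @^-1` (~` B) : set (T * T)).
  by rewrite -[X in measurable X]setTI; apply: measurable_snd => //; exact: measurableC.
apply/eqP; rewrite -measure_le0.
apply: (@le_trans _ _ (pi ((fst @^-1` (~` A)) `|` (snd @^-1` (~` B))))).
  apply: le_measure; rewrite ?inE; [exact: measurableC|exact: measurableU|].
  by move=> [x y] /= /not_andP.
apply: (le_trans (measureU2 _ mA' mB')).
have [pA _] := cpl _ (measurableC mA); have [_ pB] := cpl _ (measurableC mB).
by rewrite /= pA pB !probability_setC// A1 B1 !subee// adde0.
Qed.

(** The transport value only depends on the cost on [A `*` B]. *)
Lemma eq_QOT c1 c2 eps : measurable_fun setT c1 -> measurable_fun setT c2 ->
  (forall x y, A x -> B y -> c1 (x, y) = c2 (x, y)) ->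
  QOT P Q c1 eps = QOT P Q c2 eps.
Proof.
move=> m1 m2 c12; rewrite /QOT; congr ereal_inf; apply: eq_imagel => pi cpl.
congr (_ + _)%E.
have mAB : measurable (A `*` B) by exact: measurableX.
have AB1 := coupling_full cpl.
apply: ae_eq_integral => //; [exact/measurable_EFinP..|].
exists (~` (A `*` B)); split; first exact: measurableC.
  by apply: (etrans (probability_setC pi mAB)); rewrite AB1 subee.
move=> [x y] /= nc12; apply: contra_not nc12 => -[Ax By] _.
by rewrite c12.
Qed.

Lemma QOT_Gamma c eps fs gs : 0 < eps -> bmf c -> bmf fs -> bmf gs ->
  foc_left Q c eps A fs gs -> foc_right P c eps B fs gs ->
  QOT P Q c eps = (Gamma P Q c eps fs gs)%:E.
Proof.
move=> eps0 bc bfs bgs fl fr; apply/eqP; rewrite eq_le; apply/andP; split.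
  have [pi cpl <-] := duality_attained eps0 bc mA A1 mB B1 bfs bgs fl fr.
  by apply: ereal_inf_lbound; exists pi.
apply: le_ereal_inf_tmp => _ [pi cpl <-].
exact: weak_duality.
Qed.

End duality_truncated.

(** * Truncation to the supports *)

Section truncation.
Context {R : realType}.

Lemma bmf_restrict d (X : measurableType d) (A : set X) (F : X -> R) (K : R) :
  measurable A -> measurable_fun setT F -> (forall x, A x -> `|F x| <= K) ->
  bmf (F \_ A).
Proof.
move=> mA mF FK; split.
  by apply/(measurable_restrictT F mA); exact: measurable_funTS.
exists (Num.max K 0) => x; rewrite patchE; case: ifPn => [/set_mem/FK Fx|_].
  by rewrite le_max Fx.
by rewrite normr0 le_max lexx orbT.
Qed.

Lemma restrictT d (X : measurableType d) (A : set X) (F : X -> R) x :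
  A x -> (F \_ A) x = F x.
Proof. by move=> Ax; rewrite patchE mem_set. Qed.

Lemma bmf_L2 d (X : measurableType d) (mu : probability X R) (F : X -> R) :
  bmf F -> L2 mu F.
Proof.
move=> bF; rewrite /L2 /= inE; apply/andP; split; rewrite inE /=.
  exact: bmf_measurable.
rewrite /finite_norm; have := sqr_Lnorm2 mu F.
have bF2 : bmf (fun x => F x ^+ 2) by exact: bmfX.
rewrite bint_EFin//; have := Lnorm_ge0 mu 2%:E (EFin \o F).
by case: (Lnorm _ _ _) => [r _ _|_|//]; rewrite ?ltry.
Qed.

Lemma L2_measurable d (X : measurableType d) (mu : probability X R) (F : X -> R) :
  L2 mu F -> measurable_fun setT F.
Proof. by rewrite /L2 /= => /sub_Lfun_mfun; rewrite inE. Qed.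

Context {d : nat}.
Local Notation T := 'rV[R]_d.
Variables (P Q : probability T R) (A B : set T).
Hypotheses (mA : measurable A) (A1 : P A = 1%E).
Hypotheses (mB : measurable B) (B1 : Q B = 1%E).
Variables (c : T * T -> R) (eps : R).
Hypothesis mc : measurable_fun setT c.

Let cT : T * T -> R := c \_ (A `*` B).

Let mcT : measurable_fun setT cT.
Proof.
by apply/(measurable_restrictT c (measurableX mA mB)); exact: measurable_funTS.
Qed.

Let cTE x y : A x -> B y -> cT (x, y) = c (x, y).
Proof. by move=> Ax By; rewrite /cT patchE mem_set. Qed.

Let mres (D : set T) (h : T -> R) : measurable D -> measurable_fun setT h ->
  measurable_fun setT (h \_ D).
Proof.
by move=> mD mh; apply/(measurable_restrictT _ _).1 => //; exact: measurable_funTS.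
Qed.

Lemma measurable_pospart d' (X : measurableType d') (F : X -> R) :
  measurable_fun setT F -> measurable_fun setT (fun x => pospart (F x)).
Proof. by move=> mF; exact: measurable_maxr. Qed.

(** [Gamma] only depends on the potentials and the cost on sets of full
    measure. *)
Lemma eq_Gamma (c1 c2 : T * T -> R) (f1 f2 g1 g2 : T -> R) :
  measurable_fun setT c1 -> measurable_fun setT c2 ->
  measurable_fun setT f1 -> measurable_fun setT f2 ->
  measurable_fun setT g1 -> measurable_fun setT g2 ->
  (forall x y, A x -> B y -> c1 (x, y) = c2 (x, y)) ->
  (forall x, A x -> f1 x = f2 x) -> (forall y, B y -> g1 y = g2 y) ->
  Gamma P Q c1 eps f1 g1 = Gamma P Q c2 eps f2 g2.
Proof.
move=> mc1 mc2 mf1 mf2 mg1 mg2 c12 f12 g12; rewrite /Gamma.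
have m1 (h k : T -> R) : measurable_fun setT h -> measurable_fun setT k ->
    measurable_fun setT (oplus h k).
  move=> mh mk; apply: measurable_funD.
    exact: (measurableT_comp mh measurable_fst).
  exact: (measurableT_comp mk measurable_snd).
have m2 (h k : T -> R) (c' : T * T -> R) : measurable_fun setT h ->
    measurable_fun setT k -> measurable_fun setT c' ->
    measurable_fun setT (fun z => oplus h k z - (2 * eps)^-1 *
      pospart (oplus h k z - c' z) ^+ 2).
  move=> mh mk mc'; apply: measurable_funB; first exact: m1.
  apply: measurable_funM => //; apply: measurable_funX; apply: measurable_pospart.
  by apply: measurable_funB => //; exact: m1.
apply: (@eq_Rintegral_full _ _ _ (prodP P Q) (A `*` B)).
- exact: measurableX.
- exact: prodP_full.
- exact: m2.
- exact: m2.
- by move=> [x y] [/= Ax By]; rewrite /oplus /= f12// g12// c12.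
Qed.

Lemma Gamma_restrict (f g : T -> R) :
  measurable_fun setT f -> measurable_fun setT g ->
  Gamma P Q c eps f g = Gamma P Q cT eps (f \_ A) (g \_ B).
Proof.
move=> mf mg; apply: eq_Gamma => //; [exact: mres|exact: mres|..].
- by move=> x y Ax By; rewrite cTE.
- by move=> x Ax; rewrite restrictT.
- by move=> y By; rewrite restrictT.
Qed.

Lemma foc_left_restrict (f g : T -> R) : measurable_fun setT g ->
  foc_left Q c eps A f g -> foc_left Q cT eps A (f \_ A) (g \_ B).
Proof.
move=> mg foc x Ax; rewrite -(foc x Ax).
apply: (eq_Rintegral_full mB) => //.
- apply: measurable_pospart; apply: measurable_funB.
    by apply: measurable_funD => //; exact: mres.
  exact: measurable_fun_pair2.
- apply: measurable_pospart; apply: measurable_funB.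
    exact: measurable_funD.
  exact: measurable_fun_pair2.
- by move=> y By; rewrite !restrictT// cTE.
Qed.

Lemma foc_right_restrict (f g : T -> R) : measurable_fun setT f ->
  foc_right P c eps B f g -> foc_right P cT eps B (f \_ A) (g \_ B).
Proof.
move=> mf foc y By; rewrite -(foc y By).
apply: (eq_Rintegral_full mA) => //.
- apply: measurable_pospart; apply: measurable_funB.
    by apply: measurable_funD => //; exact: mres.
  exact: measurable_fun_pair1.
- apply: measurable_pospart; apply: measurable_funB.
    exact: measurable_funD.
  exact: measurable_fun_pair1.
- by move=> x Ax; rewrite !restrictT// cTE.
Qed.

End truncation.

Section supnorm_theory.
Context {R : realType} {d : nat}.
Local Notation T := 'rV[R]_d.
Implicit Types (A : set T) (f : T -> R).

Lemma le_supnorm A f (K : R) x : (forall x, A x -> `|f x| <= K) -> A x ->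
  `|f x| <= supnorm A f.
Proof.
move=> fK Ax; apply: ub_le_sup; last by exists x.
by exists K => _ [y Ay <-]; exact: fK.
Qed.

Lemma supnorm_le A f (K : R) : A !=set0 -> (forall x, A x -> `|f x| <= K) ->
  supnorm A f <= K.
Proof.
move=> [x Ax] fK; apply: sup_le_ub; first by exists `|f x|, x.
by move=> _ [y Ay <-]; exact: fK.
Qed.

Lemma supnorm_ge0 A f (K : R) : A !=set0 -> (forall x, A x -> `|f x| <= K) ->
  0 <= supnorm A f.
Proof. by move=> [x Ax] fK; exact: le_trans (le_supnorm fK Ax). Qed.

(** The truncations to [A] of two functions are everywhere within the distance
    of the functions on [A]. *)
Lemma restrict_dist A f1 f2 (K : R) x : A !=set0 ->
  (forall x, A x -> `|f1 x - f2 x| <= K) ->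
  `|(f1 \_ A) x - (f2 \_ A) x| <= supnorm A (f1 \- f2).
Proof.
move=> A0 fK; rewrite !patchE; case: ifPn => [/set_mem Ax|_].
  by rewrite -[f1 x - f2 x]/((f1 \- f2) x); exact: (le_supnorm (K := K)).
by rewrite subrr normr0; exact: (supnorm_ge0 (K := K)).
Qed.

End supnorm_theory.

Section foc_supnorm.
Context {R : realType} {d : nat}.
Local Notation T := 'rV[R]_d.
Variables (P Q : probability T R) (A B : set T) (c : T * T -> R) (eps K : R).
Hypotheses (eps0 : 0 < eps) (bc : bmf c) (A0 : A !=set0) (B0 : B !=set0).
Variables f1 g1 f2 g2 : T -> R.
Hypotheses (bf1 : bmf (f1 \_ A)) (bg1 : bmf (g1 \_ B)).
Hypotheses (bf2 : bmf (f2 \_ A)) (bg2 : bmf (g2 \_ B)).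

(** The map sending one potential to the solution of the first-order condition
    for the other is nonexpansive for the supremum norm. *)
Lemma foc_left_supnorm : (forall y, B y -> `|g1 y - g2 y| <= K) ->
  foc_left Q c eps A (f1 \_ A) (g1 \_ B) ->
  foc_left Q c eps A (f2 \_ A) (g2 \_ B) ->
  forall x, A x -> `|f1 x - f2 x| <= supnorm B (g1 \- g2).
Proof.
move=> gK foc1 foc2 x Ax; rewrite -(restrictT f1 Ax) -(restrictT f2 Ax).
have bcx : bmf (fun y => c (x, y)) by exact: bmf_pair2.
apply: (@foc_level_dist _ _ _ Q (fun y => (g1 \_ B) y - c (x, y))
  (fun y => (g2 \_ B) y - c (x, y)) _ _ _ eps) => //; [exact: bmfB|exact: bmfB|..].
- move=> y; rewrite opprB addrA subrK; exact: restrict_dist gK.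
- by rewrite -[RHS](foc1 x Ax); apply: eq_Rintegral => y _; rewrite addrA.
- by rewrite -[RHS](foc2 x Ax); apply: eq_Rintegral => y _; rewrite addrA.
Qed.

Lemma foc_right_supnorm : (forall x, A x -> `|f1 x - f2 x| <= K) ->
  foc_right P c eps B (f1 \_ A) (g1 \_ B) ->
  foc_right P c eps B (f2 \_ A) (g2 \_ B) ->
  forall y, B y -> `|g1 y - g2 y| <= supnorm A (f1 \- f2).
Proof.
move=> fK foc1 foc2 y By; rewrite -(restrictT g1 By) -(restrictT g2 By).
have bcy : bmf (fun x => c (x, y)) by exact: bmf_pair1.
apply: (@foc_level_dist _ _ _ P (fun x => (f1 \_ A) x - c (x, y))
  (fun x => (f2 \_ A) x - c (x, y)) _ _ _ eps) => //; [exact: bmfB|exact: bmfB|..].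
- move=> x; rewrite opprB addrA subrK; exact: restrict_dist fK.
- rewrite -[RHS](foc1 y By); apply: eq_Rintegral => x _.
  by rewrite addrCA addrA.
- rewrite -[RHS](foc2 y By); apply: eq_Rintegral => x _.
  by rewrite addrCA addrA.
Qed.

End foc_supnorm.

(** If the positive part of [h] has mean [eps], then [h] reaches [eps]. *)
Lemma pospart_int_reached (R : realType) d (X : measurableType d)
    (mu : probability X R) (B : set X) (h : X -> R) (eps : R) :
  measurable B -> mu B = 1%E -> bmf h -> 0 < eps ->
  \int[mu]_x pospart (h x) = eps -> exists2 x, B x & eps <= h x.
Proof.
move=> mB B1 bh eps0 inth; apply: contrapT => /forall2NP noty.
have hlt x : B x -> pospart (h x) < eps.
  move=> Bx; have [//|/negP] := noty x; rewrite -ltNge => hx.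
  by rewrite /pospart gt_max hx.
have bhp := bmf_pospart bh.
pose k x := \1_B x * (eps - pospart (h x)).
have bk : bmf k.
  by apply: bmfM; [exact: bmf_indic|apply: bmfB => //; exact: bmf_cst].
have k0 : \int[mu]_x k x = 0.
  transitivity (\int[mu]_x (eps - pospart (h x))).
    apply: (eq_Rintegral_full mB) => //; first exact: bmf_measurable.
      by apply/bmf_measurable/bmfB => //; exact: bmf_cst.
    by move=> x Bx; rewrite /k indicE mem_set// mul1r.
  by rewrite bintB// ?bint_cst ?inth ?subrr//; exact: bmf_cst.
have kge0 x : 0 <= k x.
  rewrite /k indicE; have [/set_mem/hlt/ltW ?|_] := boolP (x \in B).
    by rewrite mul1r subr_ge0.
  by rewrite mul0r.
have mk : measurable_fun setT (EFin \o k) by exact/measurable_EFinP/bmf_measurable.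
have : ae_eq mu setT (EFin \o k) (cst 0%E).
  apply/(ae_eq_integral_abs mu measurableT mk).
  rewrite (_ : (\int[mu]_x _ = \int[mu]_x (k x)%:E)%E).
    by rewrite bint_EFin// k0.
  by apply: eq_integral => x _; rewrite /= ger0_norm.
move=> [N [mN N0 sub]].
suff : mu B = 0%E by rewrite B1 => /eqP; rewrite onee_eq0.
apply/eqP; rewrite -measure_le0 -N0; apply: le_measure; rewrite ?inE//.
move=> x Bx; apply: sub => /= /(_ I) [].
apply/eqP; rewrite /k indicE mem_set// mul1r gt_eqF// subr_gt0.
exact: hlt.
Qed.

Section regularity.
Context {R : realType} {d : nat}.
Local Notation T := 'rV[R]_d.
Variables (P Q : probability T R) (c : T * T -> R) (eps L : R).
Variables (A B : set T) (fs gs : T -> R).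
Hypotheses (L0 : 0 < L) (eps0 : 0 < eps).
Hypotheses (hc : elipschitz2 L c) (hfs : elipschitz_on L A fs).
Hypothesis hgs : elipschitz_on L B gs.

(** The slack is [2 * L]-Lipschitz in each variable. *)
Lemma slack_lipschitz x x' y y' : A x -> A x' -> B y -> B y' ->
  fs x + gs y - c (x, y) <= fs x' + gs y' - c (x', y') +
    2 * L * enorm (x - x') + 2 * L * enorm (y - y').
Proof.
move=> Ax Ax' By By'.
have := hfs Ax Ax'; have := hgs By By'; have := hc (x', y') (x, y).
rewrite !ler_norml => /andP[_ h1] /andP[_ h2] /andP[_ h3].
move: h1; rewrite /= (enorm_distC x' x) (enorm_distC y' y) => h1.
have hs : Num.sqrt (enorm (x - x') ^+ 2 + enorm (y - y') ^+ 2) <=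
    enorm (x - x') + enorm (y - y').
  rewrite -[leRHS]ger0_norm ?addr_ge0 ?enorm_ge0// -sqrtr_sqr ler_wsqrtr//.
  have := enorm_ge0 (x - x'); have := enorm_ge0 (y - y').
  by nra.
have : L * Num.sqrt (enorm (x - x') ^+ 2 + enorm (y - y') ^+ 2) <=
    L * (enorm (x - x') + enorm (y - y')) by rewrite ler_pM2l.
by move: h1 h2 h3; set s := Num.sqrt _; nra.
Qed.

(** The pairs of points of the supports at which the slack is at least half of
    the level [eps] that it reaches over every point. *)
Definition slack_superlevel : set (T * T) :=
  [set z | [/\ A z.1, B z.2 & eps / 2 <= fs z.1 + gs z.2 - c z]].

(** Around a point where the slack is at least [eps] it stays above [eps / 2]
    on a product of balls of radius [eps / (8 * L)]. *)
Lemma slack_superlevel_near x x' y y' : A x -> A x' -> B y -> B y' ->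
  eps <= fs x + gs y - c (x, y) ->
  enorm (x - x') <= eps / (8 * L) -> enorm (y - y') <= eps / (8 * L) ->
  slack_superlevel (x', y').
Proof.
move=> Ax Ax' By By' exy dx dy; split => //=.
have := slack_lipschitz Ax Ax' By By'.
have h1 : 2 * L * enorm (x - x') <= eps / 4.
  rewrite (_ : eps / 4 = 2 * L * (eps / (8 * L))); first by rewrite ler_pM2l ?mulr_gt0.
  by field; rewrite gt_eqF.
have h2 : 2 * L * enorm (y - y') <= eps / 4.
  rewrite (_ : eps / 4 = 2 * L * (eps / (8 * L))); first by rewrite ler_pM2l ?mulr_gt0.
  by field; rewrite gt_eqF.
by move: exy; lra.
Qed.

End regularity.

(** Half of [gamma_eps] dominates the constant given by the Poincare
    inequality; here [r] stands for [eps / (8 * L)] and [iQ] for the infimum of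
    the masses of balls. *)
Lemma poincare_const_le (R : realType) (d N : nat) (r iQ lam Lam dP : R) :
  0 < r -> 0 < iQ <= 1 -> 0 < lam -> lam <= Lam -> 0 < dP -> (0 < N)%N ->
  (2 + 6 * N%:R ^+ 2 * (Lam / lam * N%:R ^+ d) / iQ) / (dP * Num.min (r ^+ d) 1) <=
  8 * (dP^-1 * Num.max r^-1 1 ^+ d) * (Lam ^+ 2 / lam ^+ 2) *
    (N%:R ^+ (d + 2) / iQ).
Proof.
move=> r0 /andP[iQ0 iQ1] lam0 lamLam dP0 N0.
have -> : (dP * Num.min (r ^+ d) 1)^-1 = dP^-1 * Num.max r^-1 1 ^+ d.
  rewrite invfM; congr (_ * _).
  have [r1|/ltW r1] := leP r 1.
    rewrite (min_idPl _) ?exprn_ile1 ?(ltW r0)//.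
    by rewrite (max_idPl _) ?exprVn// invf_ge1.
  rewrite (min_idPr _) ?exprn_ege1// (max_idPr _) ?invr1 ?expr1n//.
  by rewrite invf_le1.
set p := dP^-1 * _; have p0 : 0 < p.
  by rewrite mulr_gt0 ?invr_gt0 ?exprn_gt0// lt_max ltr01 orbT.
have n1 : 1 <= N%:R :> R by rewrite ler1n.
set t := Lam / lam; have t1 : 1 <= t by rewrite ler_pdivlMr// mul1r.
have -> : Lam ^+ 2 / lam ^+ 2 = t ^+ 2 by rewrite /t expr_div_n.
have u1 : 1 <= N%:R ^+ d * N%:R ^+ 2 / iQ :> R.
  rewrite ler_pdivlMr// mul1r (le_trans iQ1)// -exprD exprn_ege1//.
rewrite [leLHS]mulrC exprD; set u := N%:R ^+ d * _ / iQ in u1 *.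
rewrite (_ : 6 * _ * _ / iQ = 6 * (t * u)); last by rewrite /u; ring.
rewrite (_ : 8 * p * t ^+ 2 * u = p * (8 * (t ^+ 2 * u))); last by ring.
rewrite ler_pM2l//; have : 1 <= t * u by rewrite -[leLHS]mulr1 ler_pM.
have : t * u <= t ^+ 2 * u by rewrite expr2 -mulrA ler_peMl// mulr_ge0// (le_trans ler01).
by lra.
Qed.

(** * Convergence of the iterates *)

Section coordinate_ascent_convergence.
Context {R : realType} {d : nat}.
Local Notation T := 'rV[R]_d.
Variables (eps L lamP LamP deltaP : R) (P Q : probability T R) (Om Om' : set T).
Variables (rho : T -> R) (c : T * T -> R) (fs gs : T -> R).
Hypotheses (hd : (1 <= d)%N) (heps : 0 < eps) (hOm : Om = msupport P).
Hypothesis Om_convex : convex_set (Om : set (convex_lmodType T)).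
Hypotheses (Om_compact : compact Om) (hrho : density rho P).
Hypotheses (hlamP : 0 < lamP) (hLamP : lamP < LamP).
Hypothesis rho_bounds : forall x, Om x -> lamP <= rho x <= LamP.
Hypotheses (hOm' : Om' = msupport Q) (Om'_compact : compact Om').
Hypotheses (hL : 0 < L) (hc : elipschitz2 L c) (hdelta : 0 < deltaP <= 1).
Hypothesis P_ball : forall (r : R) x, 0 < r -> Om x ->
  ((deltaP * Num.min (r ^+ d) 1)%:E <= P (eball x r))%E.
Hypothesis hpot : potentials P Q c eps L Om Om' fs gs.

Let compact_rV_measurable (K : set T) : compact K -> measurable K.
Proof.
move=> cK; have oK : open (~` K).
  by apply: closed_openC; apply: compact_closed cK; exact: norm_hausdorff.
by rewrite -[K]setCK; apply: measurableC; exact: open_measurable_mx.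
Qed.

Let mOm : measurable Om. Proof. exact: compact_rV_measurable. Qed.
Let mOm' : measurable Om'. Proof. exact: compact_rV_measurable. Qed.
Let Om1 : P Om = 1%E. Proof. by rewrite hOm msupport_full// -hOm. Qed.
Let Om'1 : Q Om' = 1%E. Proof. by rewrite hOm' msupport_full// -hOm'. Qed.

Let full_neq0 (mu : probability T R) (K : set T) : mu K = 1%E -> K !=set0.
Proof.
move=> K1; apply/set0P/eqP => K0; move: K1; rewrite K0 measure0 => /esym/eqP.
by rewrite onee_eq0.
Qed.

Let Om0 : Om !=set0. Proof. exact: full_neq0 Om1. Qed.
Let Om'0 : Om' !=set0. Proof. exact: full_neq0 Om'1. Qed.

Let bOm : bounded_set Om. Proof. exact: (compact_bounded Om_compact). Qed.
Let bOm' : bounded_set Om'. Proof. exact: (compact_bounded Om'_compact). Qed.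

Let mc : measurable_fun setT c. Proof. exact: (elipschitz2_measurable hL hc). Qed.
Let mfs : measurable_fun setT fs.
Proof. by case: hpot => -[[/= /L2_measurable]]. Qed.
Let mgs : measurable_fun setT gs.
Proof. by case: hpot => -[[/= _ /L2_measurable]]. Qed.

Let lipschitz_bounded (K : set T) (h : T -> R) : K !=set0 -> bounded_set K ->
  elipschitz_on L K h -> exists M : R, forall x, K x -> `|h x| <= M.
Proof.
move=> [x0 Kx0] /bounded_enorm[M KM] hL'; exists (`|h x0| + L * M) => x Kx.
rewrite -(subrK (h x0) (h x)) addrC (le_trans (ler_normD _ _))// lerD2l.
by rewrite (le_trans (hL' _ _ Kx Kx0))// ler_pM2l// KM.
Qed.

Let fsb : exists M : R, forall x, Om x -> `|fs x| <= M.
Proof. by apply: lipschitz_bounded => //; case: hpot. Qed.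
Let gsb : exists M : R, forall x, Om' x -> `|gs x| <= M.
Proof. by apply: lipschitz_bounded => //; case: hpot. Qed.

Let cb : exists M : R, forall z, (Om `*` Om') z -> `|c z| <= M.
Proof.
have [x0 Ox0] := Om0; have [y0 Oy0] := Om'0.
have [K1 K1P] := bounded_enorm bOm; have [K2 K2P] := bounded_enorm bOm'.
exists (`|c (x0, y0)| + L * Num.sqrt (K1 ^+ 2 + K2 ^+ 2)) => -[x y] [/= Ox Oy].
rewrite -(subrK (c (x0, y0)) (c (x, y))) addrC (le_trans (ler_normD _ _))//.
rewrite lerD2l (le_trans (hc _ _))// ler_pM2l// ler_wsqrtr//=.
have h1 := K1P _ _ Ox Ox0; have h2 := K2P _ _ Oy Oy0.
have n1 := enorm_ge0 (x - x0); have n2 := enorm_ge0 (y - y0).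
by rewrite lerD// lerXn2r ?nnegrE// (le_trans _ h1, le_trans _ h2).
Qed.

Local Notation cT := (c \_ (Om `*` Om')).
Local Notation fsT := (fs \_ Om).
Local Notation gsT := (gs \_ Om').

Let bcT : bmf (cT : T * T -> R).
Proof.
by have [M cM] := cb; apply: (bmf_restrict (K := M)) => //; exact: measurableX.
Qed.
Let bfsT : bmf (fsT : T -> R).
Proof. by have [M fM] := fsb; exact: (bmf_restrict (K := M)). Qed.
Let bgsT : bmf (gsT : T -> R).
Proof. by have [M fM] := gsb; exact: (bmf_restrict (K := M)). Qed.

Let focsl : foc_left Q cT eps Om fsT gsT.
Proof. by apply: foc_left_restrict => //; case: hpot. Qed.
Let focsr : foc_right P cT eps Om' fsT gsT.
Proof. by apply: foc_right_restrict => //; case: hpot. Qed.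

Lemma QOT_potentials : QOT P Q c eps = (Gamma P Q c eps fs gs)%:E.
Proof.
rewrite (Gamma_restrict mOm Om1 mOm' Om'1 eps mc mfs mgs).
rewrite -(QOT_Gamma mOm Om1 mOm' Om'1 heps bcT bfsT bgsT focsl focsr).
apply: (eq_QOT mOm Om1 mOm' Om'1) => //; first exact: bmf_measurable.
by move=> x y Ox Oy; rewrite restrictT.
Qed.

Let S : set (T * T) := slack_superlevel c eps Om Om' fs gs.

Let mS : measurable S.
Proof.
rewrite (_ : S = (Om `*` Om') `&`
    (fun z => fsT z.1 + gsT z.2 - cT z) @^-1` `[eps / 2, +oo[%classic).
  apply: measurableI; first exact: measurableX.
  rewrite -[X in measurable X]setTI.
  by apply: (bmf_measurable (bmf_slack bcT bfsT bgsT)) => //; exact: measurable_itv.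
apply/seteqP; split => -[x y] /=.
  by move=> [/= Ox Oy h]; rewrite in_itv /= andbT !restrictT.
by move=> [[/= Ox Oy]]; rewrite in_itv /= andbT !restrictT.
Qed.

Let slack_reached_left x : Om x ->
  exists2 y, Om' y & eps <= fs x + gs y - c (x, y).
Proof.
move=> Ox; have bx : bmf (fun y => fsT x + gsT y - cT (x, y)).
  by apply: bmfB; [apply: bmfD => //; exact: bmf_cst|exact: bmf_pair2].
have [y Oy h] := pospart_int_reached mOm' Om'1 bx heps (focsl Ox).
by exists y => //; move: h; rewrite !restrictT.
Qed.

Let slack_reached_right y : Om' y ->
  exists2 x, Om x & eps <= fs x + gs y - c (x, y).
Proof.
move=> Oy; have bx : bmf (fun x => fsT x + gsT y - cT (x, y)).
  by apply: bmfB; [apply: bmfD => //; exact: bmf_cst|exact: bmf_pair1].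
have [x Ox h] := pospart_int_reached mOm Om1 bx heps (focsr Oy).
by exists x => //; move: h; rewrite !restrictT.
Qed.

Local Notation gam := (gamma_eps Q eps Om Om' L lamP LamP deltaP).

(* [r], [iQ] and [N] are the radius, the infimum and the integer that enter
   [gamma_eps] *)
Let r := eps / (8 * L).
Let r0 : 0 < r. Proof. by rewrite divr_gt0// mulr_gt0. Qed.
Let iQ := inf [set fine (Q (eball y r)) | y in Om'].

Let iQ0 : 0 < iQ.
Proof. by rewrite /iQ hOm'; apply: inf_ball_gt0; rewrite -?hOm'. Qed.

Let iQ_le y : Om' y -> (iQ%:E <= Q (eball y r))%E.
Proof.
move=> Oy; rewrite -(fineK (fin_num_measure Q _ (measurable_eball y r))) lee_fin.
apply: ge_inf; last by exists y.
by exists 0 => _ [z _ <-]; exact: fine_ge0.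
Qed.

Let iQ1 : iQ <= 1.
Proof.
have [y Oy] := Om'0; rewrite -lee_fin (le_trans (iQ_le Oy))//.
exact: probability_le1 (measurable_eball y r).
Qed.

Let diam_gt0 : 0 < ediam Om.
Proof.
have [x Ox] := Om0.
have [y Oy yx] := density_not_singleton mOm Om1 hrho rho_bounds hd x.
apply: (@lt_le_trans _ _ (enorm (y - x))); last exact: ler_ediam.
rewrite lt_neqAle enorm_ge0 andbT eq_sym; apply: contra yx => /eqP/enorm_eq0/eqP.
by rewrite subr_eq0.
Qed.

Let N := `|Num.ceil (8 * L * ediam Om / eps)|%N.

Let arg_gt0 : 0 < 8 * L * ediam Om / eps.
Proof. by rewrite divr_gt0// !mulr_gt0. Qed.

Let NE : (Num.ceil (8 * L * ediam Om / eps))%:~R = N%:R :> R.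
Proof. by rewrite /N natr_absz gtr0_norm// ceil_gt0. Qed.

Let N0 : (0 < N)%N. Proof. by rewrite /N absz_gt0 gt_eqF// ceil_gt0. Qed.

Let diamN : ediam Om / N%:R <= r.
Proof.
rewrite ler_pdivrMr ?ltr0n// /r -NE.
rewrite -[leLHS](_ : eps / (8 * L) * (8 * L * ediam Om / eps) = _).
  by rewrite ler_pM2l ?ceil_ge.
by field; rewrite !gt_eqF.
Qed.

Let path (i : nat) (z : T * T) : T :=
  (1 - i%:R / N%:R) *: z.1 + (i%:R / N%:R) *: z.2.

Let path_in i x x' : (i <= N)%N -> Om x -> Om x' -> Om (path i (x, x')).
Proof.
move=> iN Ox Ox'; apply: (convex_setE Om_convex) => //.
by rewrite divr_ge0//= ler_pdivrMr ?ltr0n// mul1r ler_nat.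
Qed.

(** Each step of the subdivided segment has length at most [r]. *)
Let path_dist i x x' : Om x -> Om x' ->
  enorm (path i (x, x') - path i.+1 (x, x')) <= r.
Proof.
move=> Ox Ox'; rewrite (_ : _ - _ = N%:R^-1 *: (x - x')); last first.
  rewrite /path /= -natr1; apply/rowP => j; rewrite !mxE.
  by field; rewrite pnatr_eq0 -lt0n.
rewrite enormZ ger0_norm ?invr_ge0// mulrC (le_trans _ diamN)//.
by rewrite ler_pM2r ?invr_gt0 ?ltr0n// ler_ediam.
Qed.

(** The Poincare inequality for the superlevel set of the optimal slack. Every
    point of one support has a partner in the other at which the slack reaches
    [eps], because its positive part has mean [eps]; by the Lipschitz bounds,
    consecutive points of a subdivided segment then share a ball of partners. *)
Lemma potentials_poincare (a b : T -> R) : bmf a -> bmf b ->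
  \int[(P \x Q)%E]_z (a z.1 + b z.2) ^+ 2 <=
  gam / 2 * \int[(P \x Q)%E]_z (\1_S z * (a z.1 + b z.2) ^+ 2).
Proof.
move=> ba bb; have [dP0 dP1] := andP hdelta.
have [_ lfs lgs _ _] := hpot.
have p0 : 0 < deltaP * Num.min (r ^+ d) 1.
  by rewrite mulr_gt0// lt_min exprn_gt0// ltr01.
have p1 : deltaP * Num.min (r ^+ d) 1 <= 1.
  by rewrite mulr_ile1 ?(ltW dP0)// ?ge_min ?lexx ?orbT// le_min ler01 exprn_ge0// ltW.
have step i x x' : (i < N)%N -> Om x -> Om x' ->
    exists D, [/\ measurable D, (iQ%:E <= Q D)%E &
      forall y, D y -> S (path i (x, x'), y) /\ S (path i.+1 (x, x'), y)].
  move=> iN Ox Ox'.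
  have Oi := path_in (ltnW iN) Ox Ox'; have Oi1 := path_in iN Ox Ox'.
  have [y0 Oy0 hy0] := slack_reached_left Oi.
  exists (eball y0 r `&` Om'); split.
  - by apply: measurableI => //; exact: measurable_eball.
  - by rewrite (probability_setI_full mOm' Om'1 (measurable_eball y0 r)) iQ_le.
  move=> y [yy0 Oy].
  have dy : enorm (y0 - y) <= r by rewrite enorm_distC ltW.
  split; apply: (slack_superlevel_near hL hc lfs lgs _ _ _ _ hy0) => //.
    by rewrite subrr enorm0 ltW.
  exact: path_dist.
have nbr y : Om' y -> exists D, [/\ measurable D,
    ((deltaP * Num.min (r ^+ d) 1)%:E <= P D)%E & forall x, D x -> S (x, y)].
  move=> Oy; have [x0 Ox0 hx0] := slack_reached_right Oy.
  exists (eball x0 r `&` Om); split.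
  - by apply: measurableI => //; exact: measurable_eball.
  - by rewrite (probability_setI_full mOm Om1 (measurable_eball x0 r)) P_ball.
  move=> x [xx0 Ox].
  apply: (slack_superlevel_near hL hc lfs lgs _ _ _ _ hx0) => //.
    by rewrite enorm_distC ltW.
  by rewrite subrr enorm0 ltW.
have mpath i : measurable_fun setT (path i).
  apply/measurable_fun_mxP => k j; under eq_fun do rewrite !mxE.
  apply: measurable_funD; apply: measurable_funM => //.
    exact: (measurableT_comp (measurable_coord_mx k j) measurable_fst).
  exact: (measurableT_comp (measurable_coord_mx k j) measurable_snd).
have path0 z : path 0 z = z.1.
  by rewrite /path mul0r subr0 scale1r scale0r addr0.
have pathN z : path N z = z.2.
  rewrite /path divff; last by rewrite pnatr_eq0 -lt0n.
  by rewrite subrr scale0r add0r scale1r.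
have push i (G : T -> R) : (i <= N)%N -> bmf G -> (forall x, 0 <= G x) ->
    \int[(P \x P)%E]_z G (path i z) <=
    LamP / lamP * N%:R ^+ d * \int[P]_x G x.
  move=> iN bG G0.
  exact: (segment_push mOm Om1 hrho hlamP (ltW hLamP) rho_bounds Om_convex iN N0 bG G0).
apply: (le_trans (nonlocal_poincare ba bb mS mOm Om1 mOm' Om'1 iQ0 p0 mpath
  path0 pathN step push nbr p1)).
apply: ler_wpM2r.
  by apply: Rintegral_ge0 => z _; rewrite mulr_ge0 ?sqr_ge0.
rewrite /gamma_eps NE -/r -/iQ.
have iQ01 : 0 < iQ <= 1 by rewrite iQ0 iQ1.
have := poincare_const_le d r0 iQ01 hlamP (ltW hLamP) dP0 N0.
rewrite (_ : r^-1 = 8 * L / eps); last by rewrite /r invf_div.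
move=> /le_trans; apply.
set u := deltaP^-1 * _; set v := LamP ^+ 2 / _; set t := _ / iQ.
by rewrite le_eqVlt; apply/orP; left; apply/eqP; field.
Qed.


Lemma gam_ge1 : 1 <= gam.
Proof.
have [dP0 dP1] := andP hdelta.
have n1 : 1 <= N%:R :> R by rewrite ler1n.
rewrite /gamma_eps NE -/r -/iQ.
have i1 : 1 <= deltaP^-1 * Num.max (8 * L / eps) 1 ^+ d.
  rewrite -[leLHS]mulr1 ler_pM// ?invf_ge1// exprn_ege1// le_max lexx.
  by rewrite orbT.
have i2 : 1 <= LamP ^+ 2 / lamP ^+ 2.
  by rewrite -expr_div_n exprn_ege1// ler_pdivlMr// mul1r ltW.
have i3 : 1 <= N%:R ^+ (d + 2) / iQ.
  by rewrite ler_pdivlMr// mul1r (le_trans iQ1)// exprn_ege1.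
rewrite -[leLHS]mulr1 ler_pM// -[leLHS]mulr1 ler_pM//.
by rewrite -[leLHS]mulr1 ler_pM// ler1n.
Qed.

Section iterates.
Variables f g : nat -> T -> R.
Hypothesis hg0 : Linfty Om' (g 0%N).
Hypothesis hfg : coordinate_ascent P Q c eps Om Om' f g.

Let gLinfty n : Linfty Om' (g n).
Proof. by case: n => [//|n]; have [_ []] := hfg n. Qed.

Let fLinfty n : Linfty Om (f n).
Proof. by have [[]] := hfg n. Qed.

Let Linfty_bound (K : set T) (h : T -> R) : Linfty K h ->
  exists M : R, forall x, K x -> `|h x| <= M.
Proof.
move=> [_ [M [_ /(_ (M + 1))]]]; rewrite ltrDl ltr01 => /(_ isT) hM.
by exists (M + 1).
Qed.

Let mf n : measurable_fun setT (f n). Proof. by have [] := fLinfty n. Qed.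
Let mg n : measurable_fun setT (g n). Proof. by have [] := gLinfty n. Qed.

Let bfT n : bmf (f n \_ Om : T -> R).
Proof. by have [M fM] := Linfty_bound (fLinfty n); exact: (bmf_restrict (K := M)). Qed.
Let bgT n : bmf (g n \_ Om' : T -> R).
Proof. by have [M gM] := Linfty_bound (gLinfty n); exact: (bmf_restrict (K := M)). Qed.

Let fdist n : exists K : R, forall x, Om x -> `|f n x - fs x| <= K.
Proof.
have [M1 h1] := Linfty_bound (fLinfty n); have [M2 h2] := fsb.
exists (M1 + M2) => x Ox; rewrite (le_trans (ler_normB _ _))//.
by rewrite lerD// ?h1// h2.
Qed.
Let gdist n : exists K : R, forall y, Om' y -> `|g n y - gs y| <= K.
Proof.
have [M1 h1] := Linfty_bound (gLinfty n); have [M2 h2] := gsb.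
exists (M1 + M2) => x Ox; rewrite (le_trans (ler_normB _ _))//.
by rewrite lerD// ?h1// h2.
Qed.

Let focl n : foc_left Q cT eps Om (f n \_ Om) (g n \_ Om').
Proof. by apply: foc_left_restrict => //; have [[]] := hfg n. Qed.
Let focr n : foc_right P cT eps Om' (f n \_ Om) (g n.+1 \_ Om').
Proof. by apply: foc_right_restrict => //; have [_ []] := hfg n. Qed.

Local Notation af n := (supnorm Om (f n \- fs)).
Local Notation bg n := (supnorm Om' (g n \- gs)).

(** The next three lemmas are the successive nonexpansive steps. *)
Lemma supnorm_left n : af n <= bg n.
Proof.
have [K hK] := gdist n; apply: supnorm_le => // x Ox.
exact: (foc_left_supnorm heps bcT Om'0 (bgT n) bgsT hK (focl n) focsl Ox).
Qed.

Lemma supnorm_right n : bg n.+1 <= af n.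
Proof.
have [K hK] := fdist n; apply: supnorm_le => // y Oy.
exact: (foc_right_supnorm heps bcT Om0 (bfT n) bfsT hK (focr n) focsr Oy).
Qed.

Lemma supnorm_init n : bg n <= bg 0%N.
Proof.
elim: n => [//|n]; apply: le_trans.
exact: le_trans (supnorm_right n) (supnorm_left n).
Qed.

Let M := Num.max (2 * bg 0%N) eps.
Let q := eps / (2 * gam * M).
Let D n := Gamma P Q c eps fs gs - Gamma P Q c eps (f n) (g n).

Let gam0 : 0 < gam. Proof. exact: lt_le_trans gam_ge1. Qed.
Let epsM : eps <= M. Proof. by rewrite le_max lexx orbT. Qed.
Let M0 : 0 < M. Proof. exact: lt_le_trans epsM. Qed.
Let epsM2 : eps / 2 <= M.
Proof. by rewrite (le_trans _ epsM)// ler_pdivrMr// ler_peMr ?(ltW heps)// ler1n. Qed.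

Let wM n z : `|(fsT z.1 - (f n \_ Om) z.1) + (gsT z.2 - (g n \_ Om') z.2)| <= M.
Proof.
have [K1 h1] := fdist n; have [K2 h2] := gdist n.
rewrite (le_trans (ler_normD _ _))// (@le_trans _ _ (2 * bg 0%N)) ?le_max ?lexx//.
rewrite distrC [X in _ + X]distrC mulr_natl mulr2n lerD//.
  rewrite (le_trans (restrict_dist _ Om0 h1))// (le_trans (supnorm_left n))//.
  exact: supnorm_init.
by rewrite (le_trans (restrict_dist _ Om'0 h2))// supnorm_init.
Qed.

Let ba n : bmf (fun x => fsT x - (f n \_ Om) x). Proof. exact: bmfB. Qed.
Let bb n : bmf (fun y => gsT y - (g n \_ Om') y). Proof. exact: bmfB. Qed.

Let SU z : S z -> eps / 2 <= fsT z.1 + gsT z.2 - cT z.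
Proof. by case: z => x y [/= Ox Oy]; rewrite !restrictT. Qed.

Let kap0 : 0 < gam / 2. Proof. by rewrite divr_gt0. Qed.

Let DE n : D n = Gamma P Q cT eps fsT gsT -
  Gamma P Q cT eps (f n \_ Om) (g n \_ Om').
Proof. by rewrite /D -!(Gamma_restrict mOm Om1 mOm' Om'1). Qed.

Let energy n := \int[(P \x Q)%E]_z
  ((fsT z.1 - (f n \_ Om) z.1) + (gsT z.2 - (g n \_ Om') z.2)) ^+ 2.

Let energy_le n : energy n <= 2 * gam * M * D n.
Proof.
apply: (le_trans (potentials_poincare (ba n) (bb n))).
rewrite (_ : 2 * gam * M * D n = gam / 2 * (4 * M * D n)); last by field.
rewrite ler_pM2l// DE.
exact: (local_growth_gap heps bcT mOm Om1 mOm' Om'1 bfsT bgsT (bfT n) (bgT n)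
  focsl focsr epsM2 (wM n) mS SU).
Qed.

Let gM0 : 0 < 2 * gam * M.
Proof. by rewrite mulr_gt0// mulr_gt0. Qed.

Let D_ge0 n : 0 <= D n.
Proof.
have : 0 <= energy n by apply: Rintegral_ge0 => z _; exact: sqr_ge0.
by move=> /le_trans/(_ (energy_le n)); rewrite pmulr_rge0.
Qed.

(** The exact maximizations do at least as well as a gradient step. *)
Lemma gap_contraction n : D n.+1 <= (1 - q) * D n.
Proof.
have [_ [[_ argg] _ _]] := hfg n; have [[[_ argf] _ _] _] := hfg n.+1.
have bG : bmf (dual_grad P cT eps (f n \_ Om) (g n \_ Om')).
  exact: (bmf_dual_grad P Q eps bcT (bfT n) (bgT n)).
pose h y := (g n \_ Om') y + eps * dual_grad P cT eps (f n \_ Om) (g n \_ Om') y.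
have bh : bmf h by apply: bmfD => //; apply: bmfM => //; exact: bmf_cst.
have step : q * D n <= Gamma P Q cT eps (f n \_ Om) h -
    Gamma P Q cT eps (f n \_ Om) (g n \_ Om').
  rewrite DE (_ : q = eps / (4 * (gam / 2) * M)); last first.
    by rewrite /q; field; rewrite !gt_eqF.
  exact: (gap_decrease heps bcT mOm Om1 mOm' Om'1 bfsT bgsT (bfT n) (bgT n)
    focsl focsr (focl n) epsM2 (wM n) mS SU kap0
    (potentials_poincare (ba n) (bb n))).
have hE : Gamma P Q c eps (f n) h = Gamma P Q cT eps (f n \_ Om) h.
  apply: (eq_Gamma mOm Om1 mOm' Om'1) => //; try exact: bmf_measurable.
  - by move=> x y Ox Oy; rewrite restrictT.
  - by move=> x Ox; rewrite restrictT.
have h1 := argg h (bmf_L2 Q bh).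
have fL2 : L2 P (f n) by have [[[]]] := hfg n.
have h2 := argf (f n) fL2.
have h3 := Gamma_restrict mOm Om1 mOm' Om'1 eps mc (mf n) (mg n).
rewrite mulrBl mul1r; move: step; rewrite -hE -h3.
move: (q * D n) => s; rewrite /D; move: h1 h2 => /=.
move: (Gamma _ _ _ _ fs gs) (Gamma _ _ _ _ (f n) h) => u v.
by move=> h1 h2 h3'; lra.
Qed.

Let q1 : 0 <= 1 - q.
Proof.
rewrite subr_ge0 ler_pdivrMr// mul1r (le_trans epsM)//.
by rewrite ler_peMl ?(ltW M0)// (le_trans gam_ge1)// ler_peMl ?(ltW gam0)// ler1n.
Qed.

Let D_geometric n : D n <= (1 - q) ^+ n * D 0%N.
Proof.
elim: n => [|n IHn]; first by rewrite expr0 mul1r.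
by rewrite (le_trans (gap_contraction n))// exprS -mulrA ler_wpM2l.
Qed.

Let gapE n : gap P Q c eps (f n) (g n) = (D n)%:E.
Proof. by rewrite /gap QOT_potentials -EFinB. Qed.

Lemma gap_geometric n : (gap P Q c eps (f n) (g n) <=
  ((1 - q) ^+ n)%:E * gap P Q c eps (f 0%N) (g 0%N))%E.
Proof. by rewrite !gapE -EFinM lee_fin. Qed.

Lemma potentials_geometric n :
  ('N[prodP P Q]_2%:E[EFin \o (oplus (f n) (g n) \- oplus fs gs)%R] ^+ 2
     <= (2 * gam ^+ 2 * M ^+ 2 / eps)%:E * gap P Q c eps (f 0%N) (g 0%N)
        * ((1 - q) ^+ n)%:E)%E.
Proof.
rewrite sqr_Lnorm2 gapE -!EFinM.
have benergy : bmf (fun z : T * T =>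
    ((fsT z.1 - (f n \_ Om) z.1) + (gsT z.2 - (g n \_ Om') z.2)) ^+ 2).
  by apply: bmfX; apply: bmfD; [exact: bmf_fst (ba n)|exact: bmf_snd (bb n)].
have -> : (\int[prodP P Q]_z (((oplus (f n) (g n) \- oplus fs gs) z) ^+ 2)%:E =
    (energy n)%:E)%E.
  rewrite -(bint_EFin (prodP P Q) benergy); apply: ae_eq_integral => //.
  - apply/measurable_EFinP/measurable_funX/measurable_funB.
      apply: measurable_funD.
        exact: (measurableT_comp (mf n) measurable_fst).
      exact: (measurableT_comp (mg n) measurable_snd).
    apply: measurable_funD.
      exact: (measurableT_comp mfs measurable_fst).
    exact: (measurableT_comp mgs measurable_snd).
  - exact/measurable_EFinP/bmf_measurable.
  have mOO : measurable (Om `*` Om') by exact: measurableX.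
  exists (~` (Om `*` Om')); split; first exact: measurableC.
    apply: (etrans (probability_setC (prodP P Q) mOO)).
    by rewrite (prodP_full mOm Om1 mOm' Om'1) subee.
  move=> [x y] /= nz [Ox Oy]; apply: nz => _ /=; congr EFin.
  by rewrite /oplus /= !restrictT//; ring.
rewrite lee_fin (le_trans (energy_le n))//.
have C0 := ltW gM0.
apply: (le_trans (ler_wpM2l C0 (D_geometric n))).
rewrite (_ : 2 * gam ^+ 2 * M ^+ 2 / eps * D 0%N * (1 - q) ^+ n =
  (gam * (M / eps)) * (2 * gam * M * ((1 - q) ^+ n * D 0%N))); last by ring.
rewrite ler_peMl//; first by rewrite mulr_ge0// mulr_ge0// exprn_ge0.
by rewrite -[leLHS]mulr1 ler_pM ?gam_ge1// ler_pdivlMr// mul1r.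
Qed.

End iterates.

End coordinate_ascent_convergence.

Theorem corollary2p7 (R : realType) (d : nat) (hd : (1 <= d)%N)
    (eps L lamP LamP deltaP : R)
    (P Q : probability 'rV[R]_d R) (Om Om' : set 'rV[R]_d)
    (rho : 'rV[R]_d -> R) (c : 'rV[R]_d * 'rV[R]_d -> R)
    (heps : 0 < eps)
    (hOm : Om = msupport P)
    (Om_convex : convex_set (Om : set (convex_lmodType 'rV[R]_d)))
    (Om_compact : compact Om)
    (hrho : density rho P)
    (hlamP : 0 < lamP) (hLamP : lamP < LamP)
    (rho_bounds : forall x, Om x -> lamP <= rho x <= LamP)
    (hOm' : Om' = msupport Q)
    (Om'_compact : compact Om')
    (hL : 0 < L) (hc : elipschitz2 L c)
    (hdelta : 0 < deltaP <= 1)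
    (P_ball : forall (r : R) x, 0 < r -> Om x ->
       ((deltaP * Num.min (r ^+ d) 1)%:E <= P (eball x r))%E)
    (fs gs : 'rV[R]_d -> R)
    (hpot : potentials P Q c eps L Om Om' fs gs)
    (f g : nat -> 'rV[R]_d -> R)
    (hg0 : Linfty Om' (g 0%N))
    (hfg : coordinate_ascent P Q c eps Om Om' f g) :
  let gam := gamma_eps Q eps Om Om' L lamP LamP deltaP in
  let M := Num.max (2 * supnorm Om' (g 0%N \- gs)) eps in
  let q := eps / (2 * gam * M) in
  let Delta := fun n => gap P Q c eps (f n) (g n) in
  [/\ forall n, [/\ supnorm Om' (g n.+1 \- gs) <= supnorm Om (f n \- fs),
                    supnorm Om (f n \- fs) <= supnorm Om' (g n \- gs) &
                    supnorm Om' (g n \- gs) <= supnorm Om' (g 0%N \- gs)],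
      forall n, (Delta n <= ((1 - q) ^+ n)%:E * Delta 0%N)%E &
      forall n,
        ('N[prodP P Q]_2%:E[EFin \o (oplus (f n) (g n) \- oplus fs gs)%R] ^+ 2
          <= (2 * gam ^+ 2 * M ^+ 2 / eps)%:E * Delta 0%N
             * ((1 - q) ^+ n)%:E)%E].

Proof.
move=> gam M q Delta; split.
- move=> n; split.
  + exact: (supnorm_right heps hOm Om_compact hOm' Om'_compact hL hc hpot hfg).
  + exact: (supnorm_left heps hOm Om_compact hOm' Om'_compact hL hc hpot hg0 hfg).
  + exact: (supnorm_init heps hOm Om_compact hOm' Om'_compact hL hc hpot hg0 hfg).
- exact: (gap_geometric hd heps hOm Om_convex Om_compact hrho hlamP hLamP
    rho_bounds hOm' Om'_compact hL hc hdelta P_ball hpot hg0 hfg).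
- exact: (potentials_geometric hd heps hOm Om_convex Om_compact hrho hlamP hLamP
    rho_bounds hOm' Om'_compact hL hc hdelta P_ball hpot hg0 hfg).
Qed.
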